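(* Let $k\in\mathbb{N}$ and let $S_n^{(j)}=\mathrm{Scirc}(s_0^{(j)},s_1^{(j)},\dots,s_{n-1}^{(j)})$, $j=1,\dots,k$, be independent $n\times n$ skew-circulant matrices whose input sequences $\{s_i^{(j)}\}_{i\ge0}$ consist of independent real random variables with mean $0$, variance $1$ and uniformly bounded moments of every order. Then $\{n^{-1/2}S_n^{(j)}\}_{1\le j\le k}$, as elements of $(\mathcal{M}_n,\varphi_n=n^{-1}\mathbb{E}\,\mathrm{Tr})$, converge jointly in $*$-distribution to $k$ independent standard complex Gaussian variables.
   Context: $\iota=\sqrt{-1}$. The skew-circulant matrix $\mathrm{Scirc}(s_0,\dots,s_{n-1})$ has $(i,j)$ entry ($0\le i,j\le n-1$) equal to $s_{j-i}$ if $j\ge i$ and $-s_{n+j-i}$ if $j<i$. An NCP (non-commutative $*$-probability space) $(\mathcal{A},\varphi)$ is a unital complex $*$-algebra with a complex linear functional $\varphi$ satisfying $\varphi(1_{\mathcal{A}})=1$. $\mathbb{C}\langle x_1,\dots,x_p\rangle$ denotes the set of complex monomials in the non-commuting indeterminates $x_1,x_1^*,\dots,x_p,x_p^*$. Elements $\{a_{n,j}\}_{1\le j\le p}$ of NCPs $(\mathcal{A}_n,\varphi_n)$ converge (jointly) in $*$-distribution to $\{a_j\}_{1\le j\le p}\subset\mathcal{A}$ if $\lim_n\varphi_n(Q(\{a_{n,j}\}))=\varphi(Q(\{a_j\}))$ for all $Q\in\mathbb{C}\langle x_1,\dots,x_p\rangle$. $\mathcal{M}_n$ is the $*$-algebra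 of $n\times n$ random matrices all of whose entries have finite moments of all orders. A variable $a\in\mathcal{A}$ is a standard complex Gaussian variable if it is normal ($aa^*=a^*a$) and $\varphi(a^k a^{*l})=\mathbb{E}[G^k\overline{G}^{\,l}]$ for all $k,l\ge 0$, where $G=X+\iota Y$ with $X,Y$ independent real Gaussian random variables of mean $0$ and variance $1/2$. Variables $a,b$ are independent if they commute and $\varphi(a^ka^{*l}b^mb^{*n})=\varphi(a^ka^{*l})\varphi(b^mb^{*n})$ for all $k,l,m,n\ge0$; a finite collection is independent if its members commute and the analogous factorization over all members holds. *)

(* Defs.v *)
From HB Require Import structures.
From mathcomp Require Import all_boot all_order all_algebra finmap.
From mathcomp Require Import all_classical all_reals all_analysis.
From mathcomp Require Import measurable_realfun complex.

Set Implicit Arguments.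
Unset Strict Implicit.
Unset Printing Implicit Defensive.

Import Order.TTheory GRing.Theory Num.Theory numFieldNormedType.Exports.

Local Open Scope classical_set_scope.
Local Open Scope ring_scope.

(* A unital complex *-algebra; algType already carries the unit. *)
HB.mixin Record Algebra_hasStar (R : rcfType) A of GRing.Algebra R[i] A := {
  star : A -> A;
  starD : {morph star : x y / x + y};
  starZ : forall (c : R[i]) x, star (c *: x) = (c^*)%C *: star x;
  starM : forall x y, star (x * y) = star y * star x;
  starK : involutive star
}.

#[short(type="starAlgType")]
HB.structure Definition StarAlgebra (R : rcfType) :=
  {A of Algebra_hasStar R A & GRing.Algebra R[i] A}.

(* A non-commutative *-probability space: no positivity, traciality or
   compatibility with the involution is required of the functional. *)
Record ncp (R : rcfType) := Ncp {
  ncp_alg :> starAlgType R;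
  ncp_state : {scalar ncp_alg};
  ncp_state1 : ncp_state 1 = 1
}.

Section StarMonomials.
Context {R : rcfType} (p : nat).

(* The letter (i, false) stands for x_i and (i, true) for x_i^*. *)
Definition star_monomial := (R[i] * seq ('I_p * bool))%type.

Definition eval_letter (A : starAlgType R) (a : 'I_p -> A) (l : 'I_p * bool) : A :=
  if l.2 then star (a l.1) else a l.1.

Definition eval_monomial (A : starAlgType R) (a : 'I_p -> A)
    (Q : star_monomial) : A :=
  Q.1 *: \prod_(l <- Q.2) eval_letter a l.

End StarMonomials.
Arguments star_monomial : clear implicits.

(* R[i]^o carries the topology of the modulus `|_| on R[i]. *)
Definition cvg_star_distribution (R : realType) (p : nat)
    (A_ : nat -> ncp R) (a_ : forall n, 'I_p -> A_ n)
    (A : ncp R) (a : 'I_p -> A) : Prop :=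
  forall Q : star_monomial R p,
    (fun n => ncp_state (A_ n) (eval_monomial (a_ n) Q) : R[i]^o) @ \oo -->
    (ncp_state A (eval_monomial a Q) : R[i]^o).

Section ComplexRandomVariables.
Context d (T : measurableType d) (R : realType) (P : probability T R).
Implicit Types Z W : T -> R[i].

Definition cexpectation Z : R[i] :=
  (fine 'E_P[fun w => complex.Re (Z w)] +i*
   fine 'E_P[fun w => complex.Im (Z w)])%C.

Definition finite_moments Z : Prop :=
  [/\ measurable_fun [set: T] (fun w => complex.Re (Z w)),
      measurable_fun [set: T] (fun w => complex.Im (Z w)) &
      forall m : nat, ('E_P[fun w => (Normc.normc (Z w) ^+ m)%R] < +oo)%E].

Lemma measurable_normc Z :
  measurable_fun [set: T] (fun w => complex.Re (Z w)) ->
  measurable_fun [set: T] (fun w => complex.Im (Z w)) ->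
  measurable_fun [set: T] (fun w => Normc.normc (Z w)).
Proof.
move=> mr mi.
have -> : (fun w => Normc.normc (Z w)) =
    (Num.sqrt \o (fun w => complex.Re (Z w) ^+ 2 + complex.Im (Z w) ^+ 2)).
  by apply/funext => w /=; case: (Z w).
apply: measurableT_comp.
  by apply: continuous_measurable_fun; exact: sqrt_continuous.
by apply: measurable_funD; apply: measurable_funX.
Qed.

Lemma normc_ge0 (z : R[i]) : 0 <= Normc.normc z.
Proof. by case: z => a b; exact: sqrtr_ge0. Qed.

Lemma finite_moments_integrable Z m : finite_moments Z ->
  P.-integrable [set: T] (EFin \o (fun w => Normc.normc (Z w) ^+ m)).
Proof.
move=> [mr mi hm]; apply/integrableP; split.
  apply/measurable_EFinP; apply: measurable_funX; exact: measurable_normc.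
have := hm m; rewrite unlock; congr (_ < _)%E; apply: eq_integral => w _ /=.
by rewrite ger0_norm// exprn_ge0// normc_ge0.
Qed.

Lemma finite_moments_dom Z :
  measurable_fun [set: T] (fun w => complex.Re (Z w)) ->
  measurable_fun [set: T] (fun w => complex.Im (Z w)) ->
  (forall m, exists2 g : T -> R, P.-integrable [set: T] (EFin \o g) &
     forall w, Normc.normc (Z w) ^+ m <= g w) ->
  finite_moments Z.
Proof.
move=> mr mi hg; split=> // m; have [g ig le_g] := hg m.
have : P.-integrable [set: T] (EFin \o (fun w => Normc.normc (Z w) ^+ m)).
  apply: (le_integrable _ _ _ ig) => //.
    apply/measurable_EFinP; apply: measurable_funX; exact: measurable_normc.
  move=> w _ /=; rewrite lee_fin ger0_norm ?exprn_ge0 ?normc_ge0//.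
  exact: le_trans (le_g w) (ler_norm _).
move=> /integrableP[_]; rewrite unlock; congr (_ < _)%E.
apply: eq_integral => w _ /=.
by rewrite ger0_norm// exprn_ge0// normc_ge0.
Qed.

Lemma finite_moments_cst c : finite_moments (fun=> c).
Proof.
apply: finite_moments_dom => [||m]; [exact: measurable_cst..|].
exists (cst (Normc.normc c ^+ m)) => //.
exact: finite_measure_integrable_cst.
Qed.

Lemma finite_momentsD Z W : finite_moments Z -> finite_moments W ->
  finite_moments (fun w => Z w + W w).
Proof.
move=> fZ fW; case: (fZ) (fW) => mrZ miZ _ [mrW miW _].
apply: finite_moments_dom => [||m].
- rewrite (_ : (fun w => _) =
    (fun w => complex.Re (Z w)) \+ (fun w => complex.Re (W w))).
    exact: measurable_funD.
  by apply/funext => w /=; case: (Z w) (W w) => ? ? [].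
- rewrite (_ : (fun w => _) =
    (fun w => complex.Im (Z w)) \+ (fun w => complex.Im (W w))).
    exact: measurable_funD.
  by apply/funext => w /=; case: (Z w) (W w) => ? ? [].
exists (fun w => 2 ^+ m * (Normc.normc (Z w) ^+ m + Normc.normc (W w) ^+ m)).
  pose f (V : T -> R[i]) := EFin \o (fun w => Normc.normc (V w) ^+ m).
  rewrite (_ : _ \o _ = (fun w => (2 ^+ m)%:E * (f Z w + f W w))%E)//.
  apply: integrableZl => //.
  by apply: integrableD => //; exact: finite_moments_integrable.
move=> w; have zge := normc_ge0 (Z w); have wge := normc_ge0 (W w).
have le1 : Normc.normc (Z w + W w) <= Normc.normc (Z w) + Normc.normc (W w).
  exact: (@le_normcD R (Z w) (W w)).
have le2 : Normc.normc (Z w + W w) <=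
    2 * Num.max (Normc.normc (Z w)) (Normc.normc (W w)).
  apply: (le_trans le1); rewrite mulrDl mul1r lerD// le_max lexx ?orbT//.
apply: (@le_trans _ _ ((2 * Num.max (Normc.normc (Z w)) (Normc.normc (W w))) ^+ m)).
  by rewrite lerXn2r ?nnegrE ?normc_ge0// mulr_ge0// le_max zge.
rewrite exprMn; apply: ler_wpM2l; first by rewrite exprn_ge0.
case: (leP (Normc.normc (Z w)) (Normc.normc (W w))) => _.
  by rewrite lerDr exprn_ge0.
by rewrite lerDl exprn_ge0.
Qed.

Lemma finite_momentsM Z W : finite_moments Z -> finite_moments W ->
  finite_moments (fun w => Z w * W w).
Proof.
move=> fZ fW; case: (fZ) (fW) => mrZ miZ _ [mrW miW _].
apply: finite_moments_dom => [||m].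
- rewrite (_ : (fun w => _) =
    ((fun w => complex.Re (Z w)) \* (fun w => complex.Re (W w))) \-
    ((fun w => complex.Im (Z w)) \* (fun w => complex.Im (W w)))).
    by apply: measurable_funB; apply: measurable_funM.
  by apply/funext => w /=; case: (Z w) (W w) => ? ? [].
- rewrite (_ : (fun w => _) =
    ((fun w => complex.Re (Z w)) \* (fun w => complex.Im (W w))) \+
    ((fun w => complex.Im (Z w)) \* (fun w => complex.Re (W w)))).
    by apply: measurable_funD; apply: measurable_funM.
  by apply/funext => w /=; case: (Z w) (W w) => ? ? [].
exists (fun w => Normc.normc (Z w) ^+ (2 * m) + Normc.normc (W w) ^+ (2 * m)).
  pose f (V : T -> R[i]) := EFin \o (fun w => Normc.normc (V w) ^+ (2 * m)).
  rewrite (_ : _ \o _ = (fun w => f Z w + f W w)%E)//.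
  by apply: integrableD => //; exact: finite_moments_integrable.
move=> w; have zge := normc_ge0 (Z w); have wge := normc_ge0 (W w).
rewrite Normc.normcM exprMn mulnC !exprM.
set a := _ ^+ m; set b := _ ^+ m.
have a0 : 0 <= a by rewrite exprn_ge0.
have b0 : 0 <= b by rewrite exprn_ge0.
have [ab|ba] := leP a b.
  apply: (@le_trans _ _ (b ^+ 2)); first by rewrite expr2 ler_wpM2r.
  by rewrite lerDr exprn_ge0.
apply: (@le_trans _ _ (a ^+ 2)); first by rewrite expr2 ler_wpM2l// ltW.
by rewrite lerDl exprn_ge0.
Qed.

Lemma finite_moments_conj Z : finite_moments Z ->
  finite_moments (fun w => ((Z w)^*)%C).
Proof.
move=> [mr mi hm]; split.
- rewrite (_ : (fun w => _) = (fun w => complex.Re (Z w)))//.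
  by apply/funext => w; case: (Z w).
- rewrite (_ : (fun w => _) = (fun w => - complex.Im (Z w))).
    exact: measurableT_comp.
  by apply/funext => w; case: (Z w).
- move=> m; have := hm m; congr (_ < _)%E; congr ('E_P[_])%E.
  by apply/funext => w; case: (Z w) => a b /=; rewrite sqrrN.
Qed.

Lemma finite_moments_sum (I : Type) (r : seq I) (Z_ : I -> T -> R[i]) :
  (forall i, finite_moments (Z_ i)) ->
  finite_moments (fun w => \sum_(i <- r) Z_ i w).
Proof.
move=> fZ; elim: r => [|i r IH].
  rewrite (_ : (fun w => _) = fun=> 0); last first.
    by apply/funext => w; rewrite big_nil.
  exact: finite_moments_cst.
rewrite (_ : (fun w => _) = fun w => Z_ i w + \sum_(i <- r) Z_ i w).
  exact: finite_momentsD.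
by apply/funext => w; rewrite big_cons.
Qed.

Lemma finite_moments_Re Z : finite_moments Z ->
  P.-integrable [set: T] (EFin \o (fun w => complex.Re (Z w))).
Proof.
move=> fZ; have [mr mi _] := fZ.
apply: (le_integrable _ _ _ (finite_moments_integrable 1 fZ)) => //.
  exact/measurable_EFinP.
move=> w _ /=; rewrite lee_fin expr1 [leRHS]ger0_norm ?normc_ge0//.
by case: (Z w) => a b /=; rewrite -sqrtr_sqr ler_wsqrtr// lerDl sqr_ge0.
Qed.

Lemma finite_moments_Im Z : finite_moments Z ->
  P.-integrable [set: T] (EFin \o (fun w => complex.Im (Z w))).
Proof.
move=> fZ; have [mr mi _] := fZ.
apply: (le_integrable _ _ _ (finite_moments_integrable 1 fZ)) => //.
  exact/measurable_EFinP.
move=> w _ /=; rewrite lee_fin expr1 [leRHS]ger0_norm ?normc_ge0//.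
by case: (Z w) => a b /=; rewrite -sqrtr_sqr ler_wsqrtr// lerDr sqr_ge0.
Qed.

Lemma cexpectation_cst c : cexpectation (fun=> c) = c.
Proof.
by case: c => a b; rewrite /cexpectation !expectation_cst.
Qed.

Lemma cexpectationD Z W : finite_moments Z -> finite_moments W ->
  cexpectation (fun w => Z w + W w) = cexpectation Z + cexpectation W.
Proof.
move=> fZ fW; rewrite /cexpectation unlock.
rewrite [RHS]/GRing.add /=; congr (_ +i* _)%C.
- rewrite -RintegralD//; [|exact: finite_moments_Re..].
  by congr fine; apply: eq_integral => w _; case: (Z w) (W w) => ? ? [].
- rewrite -RintegralD//; [|exact: finite_moments_Im..].
  by congr fine; apply: eq_integral => w _; case: (Z w) (W w) => ? ? [].
Qed.

Lemma cexpectationZ c Z : finite_moments Z ->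
  cexpectation (fun w => c * Z w) = c * cexpectation Z.
Proof.
move=> fZ; rewrite /cexpectation unlock; case: c => a b.
have ir := finite_moments_Re fZ; have ii := finite_moments_Im fZ.
have iM (x : R) (f : T -> R) : P.-integrable [set: T] (EFin \o f) ->
    P.-integrable [set: T] (EFin \o (fun w => x * f w)).
  move=> fi; rewrite (_ : _ \o _ = (fun w => x%:E * (EFin \o f) w)%E)//.
  exact: integrableZl.
rewrite [RHS]/GRing.mul /=; congr (_ +i* _)%C.
- rewrite -!RintegralZl// -RintegralB//; [|exact: iM..].
  by congr fine; apply: eq_integral => w _; case: (Z w) => ? ?.
- rewrite -!RintegralZl// -RintegralD//; [|exact: iM..].
  by congr fine; apply: eq_integral => w _; case: (Z w) => ? ?.
Qed.

End ComplexRandomVariables.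

(* Indexed so that rmatrix P n is the algebra of random matrices of size n.+1:
   the normalized trace needs a positive size. Random matrices are functions,
   not classes modulo almost sure equality. *)
Section RandomMatrices.
Context d (T : measurableType d) (R : realType) (P : probability T R) (n : nat).

Definition finite_moments_mx : pred (T -> 'M[R[i]]_n.+1) :=
  fun X => `[< forall i j, finite_moments P (fun w => X w i j) >].

Definition rmatrix : Type := {X : T -> 'M[R[i]]_n.+1 | finite_moments_mx X}.
HB.instance Definition _ := [isSub of rmatrix for @sval _ _].
HB.instance Definition _ := [Choice of rmatrix by <:].

Lemma rmatrix_submod_closed : submod_closed finite_moments_mx.
Proof.
split=> [|c X Y /asboolP fX /asboolP fY]; apply/asboolP => i j.
  rewrite (_ : (fun w => _) = fun=> 0); first exact: finite_moments_cst.
  by apply/funext => w; rewrite mxE.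
rewrite (_ : (fun w => _) = fun w => (fun=> c) w * X w i j + Y w i j).
  by apply: finite_momentsD => //; apply: finite_momentsM => //;
    exact: finite_moments_cst.
by apply/funext => w; rewrite !mxE.
Qed.

Lemma rmatrix_mulr_closed : mulr_closed finite_moments_mx.
Proof.
split=> [|X Y /asboolP fX /asboolP fY]; apply/asboolP => i j.
  rewrite (_ : (fun w => _) = fun=> (1%:M : 'M[R[i]]_n.+1) i j)//.
  exact: finite_moments_cst.
rewrite (_ : (fun w => _) = fun w => \sum_k X w i k * Y w k j).
  by apply: finite_moments_sum => k; exact: finite_momentsM.
by apply/funext => w; rewrite [LHS]mxE.
Qed.

HB.instance Definition _ :=
  GRing.isMulClosed.Build _ finite_moments_mx rmatrix_mulr_closed.
HB.instance Definition _ :=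
  GRing.isSubmodClosed.Build _ _ finite_moments_mx rmatrix_submod_closed.
HB.instance Definition _ := [SubChoice_isSubNzRing of rmatrix by <:].
HB.instance Definition _ := [SubZmodule_isSubLmodule of rmatrix by <:].

Lemma rmatrix_scalerAl (c : R[i]) (X Y : rmatrix) : c *: (X * Y) = c *: X * Y.
Proof.
by apply: val_inj; apply/funext => w /=; exact: scalerAl.
Qed.

Lemma rmatrix_scalerAr (c : R[i]) (X Y : rmatrix) : c *: (X * Y) = X * (c *: Y).
Proof.
by apply: val_inj; apply/funext => w /=; exact: scalerAr.
Qed.

HB.instance Definition _ :=
  GRing.Lmodule_isLalgebra.Build _ rmatrix rmatrix_scalerAl.
HB.instance Definition _ :=
  GRing.Lalgebra_isAlgebra.Build _ rmatrix rmatrix_scalerAr.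

Definition rmatrix_fun (X : rmatrix) : T -> 'M[R[i]]_n.+1 := sval X.

Lemma rmatrix_adj_subproof (X : rmatrix) :
  finite_moments_mx (fun w => map_mx conjc (rmatrix_fun X w)^T).
Proof.
have /asboolP fX := valP X; apply/asboolP => i j.
rewrite (_ : (fun w => _) = fun w => ((rmatrix_fun X w j i)^*)%C).
  by apply: finite_moments_conj; exact: fX.
by apply/funext => w; rewrite !mxE.
Qed.

Definition rmatrix_adj (X : rmatrix) : rmatrix := Sub _ (rmatrix_adj_subproof X).

Lemma rmatrix_adjD : {morph rmatrix_adj : X Y / X + Y}.
Proof.
move=> X Y; apply: val_inj; apply/funext => w; apply/matrixP => i j.
by rewrite !mxE rmorphD.
Qed.

Lemma rmatrix_adjZ (c : R[i]) X : rmatrix_adj (c *: X) = (c^*)%C *: rmatrix_adj X.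
Proof.
apply: val_inj; apply/funext => w; apply/matrixP => i j.
by rewrite !mxE rmorphM.
Qed.

Lemma rmatrix_adjM X Y : rmatrix_adj (X * Y) = rmatrix_adj Y * rmatrix_adj X.
Proof.
apply: val_inj; apply/funext => w; apply/matrixP => i j.
rewrite !mxE rmorph_sum; apply: eq_bigr => k _.
by rewrite !mxE rmorphM mulrC.
Qed.

Lemma rmatrix_adjK : involutive rmatrix_adj.
Proof.
move=> X; apply: val_inj; apply/funext => w; apply/matrixP => i j.
by rewrite !mxE conjcK.
Qed.

HB.instance Definition _ := Algebra_hasStar.Build R rmatrix
  rmatrix_adjD rmatrix_adjZ rmatrix_adjM rmatrix_adjK.

Definition rmatrix_state (X : rmatrix) : R[i] :=
  n.+1%:R^-1 * cexpectation P (fun w => \tr (rmatrix_fun X w)).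

Lemma rmatrix_tr_moments (X : rmatrix) :
  finite_moments P (fun w => \tr (rmatrix_fun X w)).
Proof.
have /asboolP fX := valP X.
by apply: finite_moments_sum => i; exact: fX.
Qed.

Lemma rmatrix_state_scalar : scalar rmatrix_state.
Proof.
move=> c X Y; rewrite /rmatrix_state.
rewrite (_ : (fun w => _) =
    fun w => c * \tr (rmatrix_fun X w) + \tr (rmatrix_fun Y w)); last first.
  by apply/funext => w; rewrite /rmatrix_fun /= mxtraceD mxtraceZ.
rewrite cexpectationD ?cexpectationZ ?mulrDr 1?mulrCA//.
- exact: rmatrix_tr_moments.
- by apply: finite_momentsM; [exact: finite_moments_cst|exact: rmatrix_tr_moments].
- exact: rmatrix_tr_moments.
Qed.

HB.instance Definition _ :=
  GRing.isLinear.Build _ rmatrix R[i] *%R rmatrix_state rmatrix_state_scalar.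

Lemma rmatrix_state1 : rmatrix_state 1 = 1.
Proof.
rewrite /rmatrix_state (_ : (fun w => _) = fun=> n.+1%:R).
  by rewrite cexpectation_cst mulVf// pnatr_eq0.
by apply/funext => w; exact: mxtrace1.
Qed.

Definition rmatrix_ncp : ncp R := Ncp (ncp_state := rmatrix_state) rmatrix_state1.

End RandomMatrices.

Section StandardComplexGaussian.
Context {R : realType}.

(* The second parameter of normal_prob is the standard deviation. *)
Definition gauss_half : probability (measurableTypeR R) R :=
  normal_prob 0 (Num.sqrt (2^-1 : R)).

Definition gauss_pair : probability _ R := (gauss_half \x gauss_half)%E.

Definition complex_gaussian_moment (k l : nat) : R[i] :=
  cexpectation gauss_pair
    (fun g => let G := (g.1 +i* g.2)%C in G ^+ k * ((G^*)%C) ^+ l).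

Definition standard_complex_gaussian (A : ncp R) (a : A) : Prop :=
  a * star a = star a * a /\
  forall k l : nat,
    ncp_state A (a ^+ k * star a ^+ l) = complex_gaussian_moment k l.

(* Zero exponents give the factorization over subfamilies; for p = 2 this is
   independence of a pair. The noncommutative product is in increasing order
   of the indices. *)
Definition ncp_independent (A : ncp R) (p : nat) (a : 'I_p -> A) : Prop :=
  (forall i j, a i * a j = a j * a i) /\
  forall k l : 'I_p -> nat,
    ncp_state A (\prod_(i < p) (a i ^+ k i * star (a i) ^+ l i)) =
    \prod_(i < p) ncp_state A (a i ^+ k i * star (a i) ^+ l i).

End StandardComplexGaussian.

Definition skew_circulant (V : zmodType) (n : nat) (s : nat -> V) : 'M[V]_n :=
  \matrix_(i < n, j < n)
    if (i <= j)%N then s (j - i)%N else - s (n + j - i)%N.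

Section ClassicalIndependence.
Context d (T : measurableType d) (R : realType) (P : probability T R).

Definition independent_systems (I : choiceType) (F : I -> set_system T) : Prop :=
  forall (J : {fset I}) (E : I -> set T),
    (forall i, i \in J -> F i (E i)) ->
    P (\bigcap_(i in [set` J]) E i) = (\prod_(i <- J) P (E i))%E.

Definition sigma_of_rv (X : T -> R) : set_system T :=
  preimage_set_system [set: T] X measurable.

(* The sigma-algebra generated by all the entries of a random matrix. *)
Definition sigma_of_rmx (n : nat) (X : T -> 'M[R]_n) : set_system T :=
  <<s [set E | exists i j, sigma_of_rv (fun w => X w i j) E] >>.

Definition independent_rvs (I : choiceType) (X : I -> T -> R) : Prop :=
  independent_systems (fun i => sigma_of_rv (X i)).

Definition independent_rmxs (I : choiceType) (n : nat)
    (X : I -> T -> 'M[R]_n) : Prop :=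
  independent_systems (fun i => sigma_of_rmx (X i)).

End ClassicalIndependence.

Section RandomSkewCirculant.
Context d (T : measurableType d) (R : realType) (P : probability T R).

Definition bounded_moments (s : nat -> {RV P >-> R}) : Prop :=
  forall m : nat, exists C : R, forall i : nat,
    ('E_P[fun w => (`|s i w| ^+ m)%R] <= C%:E)%E.

Definition random_skew_circulant (n : nat) (s : nat -> {RV P >-> R}) :
    T -> 'M[R]_n :=
  fun w => skew_circulant n (fun i => s i w).

Lemma random_skew_circulant_moments (n : nat) (s : nat -> {RV P >-> R}) :
  bounded_moments s ->
  finite_moments_mx P
    (fun w => map_mx (real_complex R) (random_skew_circulant n.+1 s w)).
Proof.
move=> bs; apply/asboolP => i j.
have fs m : finite_moments P (fun w => ((s m w)%:C)%C).
  split=> [||q]; [exact: measurable_funP|exact: measurable_cst|].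
  have [C /(_ m) sC] := bs q; apply: le_lt_trans (ltry C).
  apply: le_trans sC; rewrite le_eqVlt; apply/orP; left; apply/eqP.
  congr ('E_P[_])%E; apply/funext => w /=.
  by rewrite expr0n /= addr0 sqrtr_sqr.
rewrite (_ : (fun w => _) = fun w => (fun=> if (i <= j)%N then 1 else - 1) w *
  ((s (if (i <= j)%N then j - i else n.+1 + j - i)%N w)%:C)%C).
  by apply: finite_momentsM => //; exact: finite_moments_cst.
apply/funext => w; rewrite !mxE; case: ifP => _; first by rewrite mul1r.
by rewrite rmorphN mulN1r.
Qed.

Definition skew_circulant_rmatrix (n : nat) (s : nat -> {RV P >-> R})
    (bs : bounded_moments s) : rmatrix P n :=
  Sub _ (random_skew_circulant_moments n bs).

End RandomSkewCirculant.

(* Main.v *)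
Require Import Defs.
From HB Require Import structures.
From mathcomp Require Import all_boot all_order all_algebra finmap.
From mathcomp Require Import all_classical all_reals all_analysis.
From mathcomp Require Import measurable_realfun complex zify ring.

Set Implicit Arguments.
Unset Strict Implicit.
Unset Printing Implicit Defensive.

Import Order.TTheory GRing.Theory Num.Theory numFieldNormedType.Exports.

Local Open Scope classical_set_scope.
Local Open Scope ring_scope.

(** The vectors [(1, z, ..., z ^+ n)] with [z ^+ n.+1 = -1] diagonalize all
    skew-circulant matrices of size [n.+1] and their adjoints simultaneously
    ([trace_skew_circulant_word]). Hence the state of a word in the matrices is
    the average, over these [n.+1] roots [z], of the expectation of the same word
    in the commuting eigenvalues [Z_j = sum_m h * z ^+ m * s j m], where
    [h = 1 / sqrt n.+1]. In a word only the number of occurrences of each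
    letter matters, and the matrices are independent, so the expectation is a
    product over [j] of mixed moments [E (Z ^+ k * Z^* ^+ l)].

    These mixed moments are computed by an approximate form of Gaussian
    integration by parts ([star_moment_stein]). Write one factor [Z] as its sum
    and expand the remaining factors around the sum without [s m]: independence,
    mean zero and variance one leave, for each [m], the first-order terms. The
    terms in which [Z] meets another [Z] add up to a multiple of
    [sum_m (h * z ^+ m) ^+ 2], which is zero as soon as [z ^+ 2 != 1]; those in
    which it meets some [Z^*] add up to [l * E (Z ^+ k.-1 * Z^* ^+ l.-1)]; the
    rest is [O(h)], because the moments of all partial sums are bounded
    ([star_moment_bounded]). By induction the mixed moment is within [O(h)] of
    [k!] when [k = l] and of [0] otherwise, uniformly in [z]
    ([star_moment_limit]). Only the root [z = -1], present for odd sizes,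
    violates [z ^+ 2 != 1]; its share in the average is [O(1 / n)].

    The numbers obtained are the moments of a standard complex Gaussian
    variable ([complex_gaussian_momentE]), by exact integration by parts against
    the normal density. The limiting variables are realized as random matrices
    of size one over a product of Gaussian probability spaces
    ([gaussian_model]).

    Independence is used in one form ([decoupled_cons]): a variable carried by
    one system of a mutually independent family is uncorrelated with any variable
    that is itself uncorrelated with the events of the other systems. *)

(** * Uncorrelated real variables *)

Section RealIntegral.
Context d (T : measurableType d) (R : realType) (mu : {measure set T -> \bar R}).
Implicit Types f g : T -> R.

Lemma Rintegral_sum (I : Type) (r : seq I) (F : I -> T -> R) :
  (forall i, mu.-integrable [set: T] (EFin \o F i)) ->
  mu.-integrable [set: T] (EFin \o (fun w => \sum_(i <- r) F i w)) /\
  \int[mu]_w (\sum_(i <- r) F i w) = \sum_(i <- r) \int[mu]_w F i w.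
Proof.
move=> iF; elim: r => [|i r [IH1 IH2]].
  rewrite (_ : (fun w => _) = cst 0); last by apply/funext => w; rewrite big_nil.
  split; first exact: integrable0.
  by rewrite big_nil /Rintegral integral0.
rewrite (_ : (fun w => _) = fun w => F i w + \sum_(i <- r) F i w); last first.
  by apply/funext => w; rewrite big_cons.
split.
  rewrite (_ : _ \o _ = (EFin \o F i) \+ (EFin \o fun w => (\sum_(i <- r) F i w)%R))%E//.
  exact: integrableD.
by rewrite RintegralD// IH2 big_cons.
Qed.

Lemma Rintegral_dominated_cvg (f_ : nat -> T -> R) f g :
  (forall n, measurable_fun [set: T] (f_ n)) -> measurable_fun [set: T] f ->
  (forall w, f_ ^~ w @ \oo --> f w) ->
  mu.-integrable [set: T] (EFin \o g) -> (forall n w, `|f_ n w| <= g w) ->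
  (fun n => \int[mu]_w f_ n w) @ \oo --> \int[mu]_w f w.
Proof.
move=> mf_ mf ff ig fg.
have [||||i1 _ c] := @dominated_convergence _ T R mu setT measurableT
  (fun n => EFin \o f_ n) (EFin \o f) (EFin \o g) _ _ _ ig.
- by move=> n; exact/measurable_EFinP.
- exact/measurable_EFinP.
- by apply: aeW => w _; apply: cvg_EFin; [exact: nearW|exact: ff].
- by apply: aeW => w n _ /=; rewrite lee_fin.
apply: fine_cvg; rewrite fineK; first exact: c.
exact: integrable_fin_num.
Qed.

End RealIntegral.

Section ProductRule.
Context d (T : measurableType d) (R : realType) (P : probability T R).
Import HBNNSimple.

Lemma Rintegral_indic (A : set T) : measurable A ->
  \int[P]_w \1_A w = fine (P A).
Proof. by move=> mA; rewrite /Rintegral integral_indic// setIT. Qed.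

Lemma integrable_indicM (A : set T) (Y : T -> R) : measurable A ->
  P.-integrable [set: T] (EFin \o Y) ->
  P.-integrable [set: T] (EFin \o (fun w => \1_A w * Y w)).
Proof.
move=> mA iY; apply: (le_integrable _ _ _ iY) => //.
  apply/measurable_EFinP; apply: measurable_funM; first exact: measurable_indic.
  by apply/measurable_EFinP; case/integrableP: iY.
move=> w _ /=; rewrite lee_fin normrM ler_piMl//.
by rewrite indicE; case: (_ \in _); rewrite ?normr1 ?normr0.
Qed.

Let nonneg_mul_indep (X Y : T -> R) (f : R -> R) :
  measurable_fun [set: T] X -> measurable_fun [set: R] f -> (forall x, 0 <= f x) ->
  P.-integrable [set: T] (EFin \o Y) ->
  P.-integrable [set: T] (EFin \o (f \o X)) ->
  P.-integrable [set: T] (EFin \o (fun w => f (X w) * Y w)) ->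
  (forall B, measurable B ->
    \int[P]_w (\1_(X @^-1` B) w * Y w) = fine (P (X @^-1` B)) * \int[P]_w Y w) ->
  \int[P]_w (f (X w) * Y w) = (\int[P]_w f (X w)) * \int[P]_w Y w.
Proof.
move=> mX mf f0 iY ifX ifXY hB.
have mY : measurable_fun [set: T] Y.
  by apply/measurable_EFinP; case/integrableP: iY.
have mEf : measurable_fun [set: R] (EFin \o f) by exact/measurable_EFinP.
pose h := nnsfun_approx measurableT mEf.
have hf x : h ^~ x @ \oo --> f x.
  have := @cvg_nnsfun_approx _ _ R setT measurableT _ mEf (fun x _ => f0 x) x I.
  by move=> /fine_cvg.
have hle n x : h n x <= f x.
  have := @le_approx _ _ R setT (EFin \o f) n x (fun x _ => f0 x) I.
  by rewrite -(nnsfun_approxE measurableT mEf) lee_fin.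
have hn n x : `|h n x| <= f x by rewrite ger0_norm.
have mh n : measurable_fun [set: T] (h n \o X).
  by apply: measurableT_comp => //.
have hE n : \int[P]_w (h n (X w) * Y w) = (\int[P]_w h n (X w)) * \int[P]_w Y w.
  have hXE w : h n (X w) = \sum_(y <- fset_set (range (h n)))
      y * \1_(X @^-1` (h n @^-1` [set y])) w.
    by rewrite [LHS]fimfunE fsbig_finite.
  have mhB y : measurable (X @^-1` (h n @^-1` [set y])).
    by rewrite -[_ @^-1` _]setTI; apply: mX => //.
  have i1 y : P.-integrable [set: T]
      (EFin \o (fun w => y * \1_(X @^-1` (h n @^-1` [set y])) w)).
    rewrite (_ : _ \o _ = (fun w => y%:E * (EFin \o \1_(X @^-1` (h n @^-1` [set y]))) w)%E)//.
    apply: integrableZl => //.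
    exact: integrable_indic.
  have i2 y : P.-integrable [set: T]
      (EFin \o (fun w => y * (\1_(X @^-1` (h n @^-1` [set y])) w * Y w))).
    rewrite (_ : _ \o _ = (fun w => y%:E *
      (EFin \o (fun w => \1_(X @^-1` (h n @^-1` [set y])) w * Y w)%R) w)%E)//.
    by apply: integrableZl => //; exact: integrable_indicM.
  under eq_Rintegral do rewrite hXE mulr_suml.
  under eq_Rintegral do under eq_bigr do rewrite -mulrA.
  under [in RHS]eq_Rintegral do rewrite hXE.
  rewrite !(Rintegral_sum _ _).2//; rewrite mulr_suml; apply: eq_bigr => y _.
  rewrite !RintegralZl//; first by rewrite hB// Rintegral_indic// mulrA.
    exact: integrable_indic.
  exact: integrable_indicM.
have c1 : (fun n => \int[P]_w (h n (X w) * Y w)) @ \oo --> \int[P]_w (f (X w) * Y w).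
  apply: (@Rintegral_dominated_cvg _ _ _ _ _ _ (fun w => `|f (X w) * Y w|)).
  - by move=> n; apply: measurable_funM => //; exact: mh.
  - by apply: measurable_funM => //; exact: measurableT_comp.
  - by move=> w; apply: cvgM; [exact: hf|exact: cvg_cst].
  - exact: integrable_abse ifXY.
  - by move=> n w; rewrite !normrM ler_wpM2r// (le_trans (hn _ _))// ler_norm.
have c2 : (fun n => \int[P]_w h n (X w)) @ \oo --> \int[P]_w f (X w).
  apply: (@Rintegral_dominated_cvg _ _ _ _ _ _ (fun w => f (X w))) => //.
  exact: measurableT_comp.
have c3 := cvgM c2 (cvg_cst (\int[P]_w Y w)).
rewrite -(cvg_lim (@Rhausdorff R) c1) -(cvg_lim (@Rhausdorff R) (c3 _ _)).
by congr (lim (_ @ \oo)); apply/funext => n; exact: hE.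
Qed.

(** Simple functions of [X] are linear combinations of indicators of events of
    [X]; approximating the positive and negative parts of [X] by them, dominated
    convergence carries uncorrelatedness with [Y] over to [X]. *)
Lemma Rintegral_mul_indep (X Y : T -> R) :
  P.-integrable [set: T] (EFin \o X) ->
  P.-integrable [set: T] (EFin \o Y) ->
  P.-integrable [set: T] (EFin \o (fun w => X w * Y w)) ->
  (forall B, measurable B ->
    \int[P]_w (\1_(X @^-1` B) w * Y w) = fine (P (X @^-1` B)) * \int[P]_w Y w) ->
  \int[P]_w (X w * Y w) = (\int[P]_w X w) * \int[P]_w Y w.
Proof.
move=> iX iY iXY hB.
have mX : measurable_fun [set: T] X.
  by apply/measurable_EFinP; case/integrableP: iX.
have mY : measurable_fun [set: T] Y.
  by apply/measurable_EFinP; case/integrableP: iY.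
pose p (x : R) := Num.max x 0; pose q (x : R) := Num.max (- x) 0.
have mp : measurable_fun [set: R] p by exact: measurable_maxr.
have mq : measurable_fun [set: R] q by apply: measurable_maxr.
have pqE x : x = p x - q x.
  rewrite /p /q; case: (leP 0 x) => x0.
    by rewrite max_r ?oppr_le0// subr0.
  by rewrite max_l ?oppr_ge0 ?ltW// sub0r opprK.
have p0 x : 0 <= p x by rewrite le_max lexx orbT.
have q0 x : 0 <= q x by rewrite le_max lexx orbT.
have pn x : `|p x| <= `|x| by rewrite ger0_norm// ge_max ler_norm normr_ge0.
have qn x : `|q x| <= `|x|.
  by rewrite ger0_norm// ge_max -normrN ler_norm normr_ge0.
have i1 (f : R -> R) : measurable_fun [set: R] f -> (forall x, `|f x| <= `|x|) ->
    P.-integrable [set: T] (EFin \o (f \o X)).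
  move=> mf fn; apply: (le_integrable _ _ _ iX) => //.
    by apply/measurable_EFinP; exact: measurableT_comp.
  by move=> w _ /=; rewrite lee_fin.
have i2 (f : R -> R) : measurable_fun [set: R] f -> (forall x, `|f x| <= `|x|) ->
    P.-integrable [set: T] (EFin \o (fun w => f (X w) * Y w)).
  move=> mf fn; apply: (le_integrable _ _ _ iXY) => //.
    by apply/measurable_EFinP; apply: measurable_funM => //; exact: measurableT_comp.
  by move=> w _ /=; rewrite lee_fin !normrM ler_wpM2r.
transitivity (\int[P]_w (p (X w) * Y w - q (X w) * Y w)).
  by apply: eq_Rintegral => w _; rewrite -mulrBl -pqE.
rewrite RintegralB//; [|exact: i2..].
rewrite !(@nonneg_mul_indep X Y)//; [|exact: i1|exact: i2|exact: i1|exact: i2].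
rewrite -mulrBl -RintegralB//; [|exact: i1..].
by congr (_ * _); apply: eq_Rintegral => w _; rewrite -pqE.
Qed.

End ProductRule.

(** * Complex expectations *)

Section ComplexParts.
Context {R : realType}.

(** Indexing the two real components by a boolean lets the four cross terms of
    a product of complex variables be treated at once. *)
Definition cpart (b : bool) (z : R[i]) : R :=
  if b then complex.Im z else complex.Re z.

Lemma normc_cpart b z : `|cpart b z| <= Normc.normc z.
Proof.
case: z => x y; rewrite /cpart -sqrtr_sqr; case: b => /=.
  by rewrite ler_wsqrtr// lerDr sqr_ge0.
by rewrite ler_wsqrtr// lerDl sqr_ge0.
Qed.

Lemma cpart_realM b (x : R) z : cpart b (x%:C%C * z) = x * cpart b z.
Proof. by case: b; case: z => u v /=; rewrite mul0r ?subr0 ?addr0. Qed.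

End ComplexParts.

Section ComplexExpectation.
Context d (T : measurableType d) (R : realType) (P : probability T R).
Implicit Types Z W : T -> R[i].

Lemma cexpectationE Z : cexpectation P Z =
  (\int[P]_w cpart false (Z w) +i* \int[P]_w cpart true (Z w))%C.
Proof. by rewrite /cexpectation unlock. Qed.

Lemma measurable_cpart b Z : finite_moments P Z ->
  measurable_fun [set: T] (fun w => cpart b (Z w)).
Proof. by case: b => -[]. Qed.

Lemma finite_moments_cpart b Z : finite_moments P Z ->
  finite_moments P (fun w => (cpart b (Z w))%:C%C).
Proof.
move=> fZ; apply: finite_moments_dom => [||m]; first exact: measurable_cpart.
  exact: measurable_cst.
exists (fun w => Normc.normc (Z w) ^+ m); first exact: finite_moments_integrable.
move=> w; rewrite lerXn2r ?nnegrE ?normc_ge0// /Normc.normc/=.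
by rewrite expr0n/= addr0 sqrtr_sqr normc_cpart.
Qed.

Lemma integrable_cpart b Z : finite_moments P Z ->
  P.-integrable [set: T] (EFin \o (fun w => cpart b (Z w))).
Proof. by move=> /(finite_moments_cpart b)/finite_moments_Re. Qed.

Lemma integrable_cpartM b b' Z W : finite_moments P Z -> finite_moments P W ->
  P.-integrable [set: T] (EFin \o (fun w => cpart b (Z w) * cpart b' (W w))).
Proof.
move=> /(finite_moments_cpart b) fZ /(finite_moments_cpart b') fW.
have := finite_moments_Re (finite_momentsM fZ fW).
by under eq_fun do rewrite /= mulr0 subr0.
Qed.

Lemma cexpectationM Z W : finite_moments P Z -> finite_moments P W ->
  (forall b b', \int[P]_w (cpart b (Z w) * cpart b' (W w)) =
     (\int[P]_w cpart b (Z w)) * \int[P]_w cpart b' (W w)) ->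
  cexpectation P (fun w => Z w * W w) = cexpectation P Z * cexpectation P W.
Proof.
move=> fZ fW h; have iZW b b' := integrable_cpartM b b' fZ fW.
pose e b b' := (\int[P]_w cpart b (Z w)) * \int[P]_w cpart b' (W w).
rewrite !cexpectationE; transitivity
  ((e false false - e true true) +i* (e false true + e true false))%C => //.
rewrite /e -!h; congr (_ +i* _)%C.
  rewrite -RintegralB//; [|exact: iZW..].
  by apply: eq_Rintegral => w _; case: (Z w) (W w) => ? ? [].
rewrite -RintegralD//; [|exact: iZW..].
by apply: eq_Rintegral => w _; case: (Z w) (W w) => ? ? [].
Qed.

Lemma cexpectation_sum (I : Type) (r : seq I) (Z_ : I -> T -> R[i]) :
  (forall i, finite_moments P (Z_ i)) ->
  cexpectation P (fun w => \sum_(i <- r) Z_ i w) =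
  \sum_(i <- r) cexpectation P (Z_ i).
Proof.
move=> fZ; elim: r => [|i r IH].
  rewrite (_ : (fun w => _) = fun=> 0) ?cexpectation_cst ?big_nil//.
  by apply/funext => w; rewrite big_nil.
rewrite big_cons -IH -cexpectationD//; last exact: finite_moments_sum.
by congr (cexpectation P _); apply/funext => w; rewrite big_cons.
Qed.

Lemma finite_momentsX Z k : finite_moments P Z ->
  finite_moments P (fun w => Z w ^+ k).
Proof.
move=> fZ; elim: k => [|k IH].
  by under eq_fun do rewrite expr0; exact: finite_moments_cst.
by under eq_fun do rewrite exprS; exact: finite_momentsM.
Qed.

Lemma finite_moments_prod (I : Type) (r : seq I) (Z_ : I -> T -> R[i]) :
  (forall i, finite_moments P (Z_ i)) ->
  finite_moments P (fun w => \prod_(i <- r) Z_ i w).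
Proof.
move=> fZ; elim: r => [|i r IH].
  by under eq_fun do rewrite big_nil; exact: finite_moments_cst.
by under eq_fun do rewrite big_cons; exact: finite_momentsM.
Qed.

Lemma finite_moments_real (X : T -> R) : measurable_fun [set: T] X ->
  (forall m : nat, ('E_P[fun w => (`|X w| ^+ m)%R] < +oo)%E) ->
  finite_moments P (fun w => (X w)%:C%C).
Proof.
move=> mX hX; split=> [||m]; [exact: mX|exact: measurable_cst|].
have := hX m; congr (_ < _)%E; congr ('E_P[_])%E.
by apply/funext => w /=; rewrite expr0n/= addr0 sqrtr_sqr.
Qed.

End ComplexExpectation.

Section ProductSpace.
Context d1 d2 (T1 : measurableType d1) (T2 : measurableType d2) (R : realType).
Variables (P : probability T1 R) (Q : probability T2 R).
Local Notation PQ := ((P \x Q)%E : probability _ R).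

Let integral_fst (f : T1 -> \bar R) : measurable_fun [set: T1] f ->
  (forall x, 0 <= f x)%E -> (\int[PQ]_z f z.1 = \int[P]_x f x)%E.
Proof.
move=> mf f0; have mff : measurable_fun [set: T1 * T2] (fun z => f z.1).
  exact: measurableT_comp.
rewrite fubini_tonelli1//; apply: eq_integral => x _.
by rewrite /fubini_F/= integral_cst// [X in (_ * X)%E]probability_setT mule1.
Qed.

Let integral_snd (f : T2 -> \bar R) : measurable_fun [set: T2] f ->
  (forall x, 0 <= f x)%E -> (\int[PQ]_z f z.2 = \int[Q]_x f x)%E.
Proof.
move=> mf f0; have mff : measurable_fun [set: T1 * T2] (fun z => f z.2).
  exact: measurableT_comp.
rewrite fubini_tonelli2//; apply: eq_integral => x _.
by rewrite /fubini_G/= integral_cst// [X in (_ * X)%E]probability_setT mule1.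
Qed.

Lemma finite_moments_fst (Z : T1 -> R[i]) : finite_moments P Z ->
  finite_moments PQ (fun z => Z z.1).
Proof.
move=> fZ; have [mr mi hm] := fZ; split=> [||m].
- exact: (measurableT_comp mr measurable_fst).
- exact: (measurableT_comp mi measurable_fst).
have := hm m; rewrite !unlock; congr (_ < _)%E; apply/esym.
apply: (integral_fst (f := fun x => (Normc.normc (Z x) ^+ m)%:E)).
  apply/measurable_EFinP; apply: measurable_funX; exact: measurable_normc.
by move=> x; rewrite lee_fin exprn_ge0// normc_ge0.
Qed.

Lemma finite_moments_snd (Z : T2 -> R[i]) : finite_moments Q Z ->
  finite_moments PQ (fun z => Z z.2).
Proof.
move=> fZ; have [mr mi hm] := fZ; split=> [||m].
- exact: (measurableT_comp mr measurable_snd).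
- exact: (measurableT_comp mi measurable_snd).
have := hm m; rewrite !unlock; congr (_ < _)%E; apply/esym.
apply: (integral_snd (f := fun x => (Normc.normc (Z x) ^+ m)%:E)).
  apply/measurable_EFinP; apply: measurable_funX; exact: measurable_normc.
by move=> x; rewrite lee_fin exprn_ge0// normc_ge0.
Qed.

Let Rintegral_fst_snd (f : T1 -> R) (g : T2 -> R) :
  P.-integrable [set: T1] (EFin \o f) -> Q.-integrable [set: T2] (EFin \o g) ->
  PQ.-integrable [set: T1 * T2] (EFin \o (fun z => f z.1 * g z.2)) ->
  \int[PQ]_z (f z.1 * g z.2) = (\int[P]_x f x) * \int[Q]_y g y.
Proof.
move=> fi gi fgi; rewrite /Rintegral -integral12_prod_meas1//.
rewrite -fineM; [|exact: integrable_fin_num..].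
congr fine; rewrite -[X in (_ * X)%E](fineK (integrable_fin_num _ gi))//.
rewrite -integralZr//; apply: eq_integral => x _; rewrite /fubini_F/=.
rewrite (fineK (integrable_fin_num _ gi))//.
transitivity (\int[Q]_y ((f x)%:E * (EFin \o g) y))%E => //.
exact: integralZl.
Qed.

Lemma cexpectation_fst_snd (Z : T1 -> R[i]) (W : T2 -> R[i]) :
  finite_moments P Z -> finite_moments Q W ->
  cexpectation PQ (fun z => Z z.1 * W z.2) = cexpectation P Z * cexpectation Q W.
Proof.
move=> fZ fW.
have one1 : finite_moments P (fun=> 1) by exact: finite_moments_cst.
have one2 : finite_moments Q (fun=> 1) by exact: finite_moments_cst.
have fZ1 := finite_moments_fst fZ; have fW2 := finite_moments_snd fW.
have marg1 b : \int[PQ]_z cpart b (Z z.1) = \int[P]_x cpart b (Z x).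
  transitivity (\int[PQ]_z (cpart b (Z z.1) * cst 1 z.2)).
    by apply: eq_Rintegral => z _; rewrite mulr1.
  rewrite (@Rintegral_fst_snd (fun x => cpart b (Z x)) (cst 1)).
  - by rewrite Rintegral_cst// mul1r [X in fine X]probability_setT mulr1.
  - exact: integrable_cpart.
  - exact: finite_measure_integrable_cst.
  - by under eq_fun do rewrite /= mulr1; exact: (integrable_cpart b fZ1).
have marg2 b : \int[PQ]_z cpart b (W z.2) = \int[Q]_x cpart b (W x).
  transitivity (\int[PQ]_z (cst 1 z.1 * cpart b (W z.2))).
    by apply: eq_Rintegral => z _; rewrite mul1r.
  rewrite (@Rintegral_fst_snd (cst 1) (fun x => cpart b (W x))).
  - by rewrite Rintegral_cst// mul1r [X in fine X]probability_setT mul1r.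
  - exact: finite_measure_integrable_cst.
  - exact: integrable_cpart.
  - by under eq_fun do rewrite /= mul1r; exact: (integrable_cpart b fW2).
rewrite (@cexpectationM _ _ _ PQ (fun z => Z z.1) (fun z => W z.2))//.
  by rewrite !cexpectationE !marg1 !marg2.
move=> b b'; rewrite marg1 marg2.
apply: (Rintegral_fst_snd (f := fun x => cpart b (Z x)) (g := fun x => cpart b' (W x))).
- exact: integrable_cpart.
- exact: integrable_cpart.
- exact: integrable_cpartM.
Qed.

End ProductSpace.

(** * Mutual independence *)

Section Decoupling.
Context d (T : measurableType d) (R : realType) (P : probability T R).
Context (I : choiceType) (F : I -> set_system T).
Hypothesis F_measurable : forall i E, F i E -> measurable E.
Hypothesis F_indep : independent_systems P F.
Implicit Types (V W : T -> R[i]) (r : seq I) (J : {fset I}).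

Let cell J (E : I -> set T) : set T := \bigcap_(i in [set` J]) E i.

Let measurable_cell J (E : I -> set T) :
  (forall i, i \in J -> F i (E i)) -> measurable (cell J E).
Proof.
move=> FE; apply: fin_bigcap_measurable; first exact: finite_fset.
by move=> i iJ; apply: (@F_measurable i); exact: FE.
Qed.

Definition adapted (G : set_system T) W : Prop :=
  forall b B, measurable B -> G ((fun w => cpart b (W w)) @^-1` B).

(** A substitute, linear in [V], for measurability of [V] with respect to the
    sigma-algebra generated by the systems indexed by [r]: linearity makes it
    stable under the expansion of polynomials, with no appeal to the fact that
    disjoint groups of independent systems generate independent sigma-algebras. *)
Definition decoupled r V : Prop :=
  finite_moments P V /\
  forall J (E : I -> set T),
    (forall i, i \in J -> F i (E i)) -> (forall i, i \in J -> i \notin r) ->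
    cexpectation P (fun w => (\1_(\bigcap_(i in [set` J]) E i) w)%:C%C * V w) =
    (fine (P (\bigcap_(i in [set` J]) E i)))%:C%C * cexpectation P V.

Lemma finite_moments_indic (A : set T) : measurable A ->
  finite_moments P (fun w => (\1_A w : R)%:C%C).
Proof.
move=> mA; apply: finite_moments_dom => [||m].
- exact: measurable_indic.
- exact: measurable_cst.
exists (cst 1); first exact: finite_measure_integrable_cst.
move=> w; rewrite /Normc.normc /= expr0n/= addr0 sqrtr_sqr.
by rewrite exprn_ile1// indicE; case: (_ \in _); rewrite ?normr1 ?normr0.
Qed.

Lemma cexpectation_indic (A : set T) : measurable A ->
  cexpectation P (fun w => (\1_A w : R)%:C%C) = (fine (P A))%:C%C.
Proof.
move=> mA; rewrite cexpectationE /cpart /= Rintegral_indic//.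
by rewrite /Rintegral integral0.
Qed.

Lemma decoupled_cst r c : decoupled r (fun=> c).
Proof.
split; first exact: finite_moments_cst.
move=> J E FE _; have mA := measurable_cell FE.
rewrite cexpectation_cst -cexpectation_indic// mulrC -cexpectationZ.
  by congr (cexpectation P _); apply/funext => w; rewrite mulrC.
exact: finite_moments_indic.
Qed.

Lemma decoupledD r V V' : decoupled r V -> decoupled r V' ->
  decoupled r (fun w => V w + V' w).
Proof.
move=> [fV hV] [fV' hV']; split; first exact: finite_momentsD.
move=> J E FE Jr; have fA := finite_moments_indic (measurable_cell FE).
under eq_fun do rewrite mulrDr.
by rewrite !cexpectationD ?hV ?hV' ?mulrDr//; exact: finite_momentsM.
Qed.

Lemma decoupledZ r c V : decoupled r V -> decoupled r (fun w => c * V w).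
Proof.
move=> [fV hV]; split.
  by apply: finite_momentsM => //; exact: finite_moments_cst.
move=> J E FE Jr; have fA := finite_moments_indic (measurable_cell FE).
under eq_fun do rewrite mulrCA.
by rewrite !cexpectationZ ?hV 1?mulrCA//; exact: finite_momentsM.
Qed.

Lemma decoupled_sum r (K : Type) (t : seq K) (V_ : K -> T -> R[i]) :
  (forall k, decoupled r (V_ k)) -> decoupled r (fun w => \sum_(k <- t) V_ k w).
Proof.
move=> dV; elim: t => [|k t IH].
  by under eq_fun do rewrite big_nil; exact: decoupled_cst.
by under eq_fun do rewrite big_cons; exact: decoupledD.
Qed.

(** If [A] is an intersection of events carried by indices outside [m :: r] and
    [C] is an event of [W], then [C `&` A] is an intersection of events outside
    [r]. Since [V] is decoupled from it and [P (C `&` A) = P C * P A], the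
    variable [1_A V] is uncorrelated with every event of [W], hence with [W]. *)
Lemma decoupled_cons r m V W : m \notin r -> decoupled r V ->
  finite_moments P W -> adapted (F m) W ->
  decoupled (m :: r) (fun w => W w * V w) /\
  cexpectation P (fun w => W w * V w) = cexpectation P W * cexpectation P V.
Proof.
move=> mr [fV hV] fW aW.
have key J (E : I -> set T) : (forall i, i \in J -> F i (E i)) ->
    (forall i, i \in J -> i \notin m :: r) ->
    cexpectation P (fun w => W w * ((\1_(cell J E) w)%:C%C * V w)) =
    cexpectation P W * ((fine (P (cell J E)))%:C%C * cexpectation P V).
  move=> FE Jmr; have mA := measurable_cell FE.
  have Jr i : i \in J -> i \notin r.
    by move=> /Jmr; rewrite inE negb_or => /andP[].
  have mJ : m \notin J by apply/negP => /Jmr; rewrite inE eqxx.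
  have fAV := finite_momentsM (finite_moments_indic mA) fV.
  rewrite -hV//; apply: cexpectationM => // b b'.
  apply: (@Rintegral_mul_indep _ _ _ P (fun w => cpart b (W w))
    (fun w => cpart b' ((\1_(cell J E) w)%:C%C * V w))).
  - exact: integrable_cpart.
  - exact: integrable_cpart.
  - exact: integrable_cpartM.
  move=> B mB; set C := (fun w => cpart b (W w)) @^-1` B.
  (* the event of [W] joins the family, at the new index [m] *)
  pose E' i := if i == m then C else E i.
  have FE' i : i \in (m |` J)%fset -> F i (E' i).
    rewrite /E' !inE; have [->|im] /= := eqVneq i m; first by move=> _; exact: aW.
    exact: FE.
  have Jr' i : i \in (m |` J)%fset -> i \notin r.
    by rewrite !inE => /orP[/eqP->|/Jr].
  have cellE : cell (m |` J)%fset E' = C `&` cell J E.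
    apply/seteqP; split=> w.
      move=> h; split; first by have := h m; rewrite /E' eqxx; apply; rewrite /= !inE eqxx.
      move=> i /= iJ; have := h i; rewrite /E' ifN; last first.
        by apply: contraNneq mJ => <-.
      by apply; rewrite /= !inE iJ orbT.
    move=> [Cw Ew] i /=; rewrite /E' !inE; have [//|im] /= := eqVneq i m.
    by move=> iJ; exact: Ew.
  have PE : P (cell (m |` J)%fset E') = (P C * P (cell J E))%E.
    rewrite /cell (F_indep FE') (F_indep FE) big_fsetU1//= /E' eqxx; congr (_ * _)%E.
    rewrite !big_seq; apply: eq_bigr => i iJ; rewrite ifN//.
    by apply: contraNneq mJ => <-.
  have mC : measurable C by apply: (@F_measurable m); exact: aW.
  have := hV _ _ FE' Jr'; rewrite -!/(cell _ _) PE fineM ?fin_num_measure//.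
  rewrite rmorphM -mulrA -hV// cellE => /(congr1 (cpart b')).
  rewrite cpart_realM !cexpectationE => e.
  have {}e : \int[P]_w cpart b' ((\1_(C `&` cell J E) w)%:C%C * V w) =
      fine (P C) * \int[P]_w cpart b' ((\1_(cell J E) w)%:C%C * V w).
    by move: e; case: (b').
  rewrite -e; apply: eq_Rintegral => w _.
  by rewrite -cpart_realM mulrA -rmorphM indicI.
have fWV := finite_momentsM fW fV.
have eWV : cexpectation P (fun w => W w * V w) =
    cexpectation P W * cexpectation P V.
  have := key fset0 (fun=> setT).
  rewrite /cell set_fset0 bigcap_set0 probability_setT mul1r => <-//.
  by congr (cexpectation P _); apply/funext => w; rewrite indicT mul1r.
split=> //; split=> // J E FE Jmr; rewrite eWV mulrCA -key//.
by congr (cexpectation P _); apply/funext => w; rewrite mulrCA.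
Qed.

Lemma decoupled_prod r (W : I -> T -> R[i]) : uniq r ->
  (forall i, finite_moments P (W i)) -> (forall i, adapted (F i) (W i)) ->
  cexpectation P (fun w => \prod_(i <- r) W i w) =
  \prod_(i <- r) cexpectation P (W i).
Proof.
move=> ur fW aW.
suff [] : decoupled r (fun w => \prod_(i <- r) W i w) /\
  cexpectation P (fun w => \prod_(i <- r) W i w) =
  \prod_(i <- r) cexpectation P (W i) by [].
elim: r ur => [_|i r IH /= /andP[ir ur]].
  under eq_fun do rewrite big_nil.
  by rewrite cexpectation_cst big_nil; split=> //; exact: decoupled_cst.
have [dV eV] := IH ur; under eq_fun do rewrite big_cons.
rewrite big_cons -eV.
by apply: decoupled_cons.
Qed.

End Decoupling.

(** * Mixed moments of weighted sums of independent variables *)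

Lemma norm_conjc (R : rcfType) (z : R[i]) : `|(z^*)%C| = `|z|.
Proof. by case: z => x y; rewrite !normc_def/= sqrrN. Qed.

Lemma mul_conjc_norm (R : rcfType) (z : R[i]) : z * (z^*)%C = `|z| ^+ 2.
Proof. by rewrite sqr_normc. Qed.

(** Each index runs one step beyond its exponent. The additional terms carry a
    zero binomial coefficient, and make the indices [0] and [1] of the constant
    and linear terms available whatever the exponents are. *)
Lemma expand_two_powers (A : comNzRingType) (k l : nat) (x y u v : A) :
  (x + u) ^+ k * (y + v) ^+ l =
  \sum_(p : 'I_k.+2 * 'I_l.+2) ('C(k, p.1) * 'C(l, p.2))%:R *
    (x ^+ p.1 * y ^+ p.2) * (u ^+ (k - p.1) * v ^+ (l - p.2)).
Proof.
have expand (n : nat) (a b : A) :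
    (a + b) ^+ n = \sum_(i < n.+2) 'C(n, i)%:R * a ^+ i * b ^+ (n - i).
  rewrite big_ord_recr/= bin_small// !mul0r addr0 addrC exprDn.
  by apply: eq_bigr => i _; rewrite -mulrA [a ^+ i * _]mulrC mulr_natl.
rewrite !expand big_distrlr/= pair_big/=; apply: eq_bigr => p _.
by rewrite natrM; ring.
Qed.

Section WeightedSums.
Context d (T : measurableType d) (R : realType) (P : probability T R).
Variable s : nat -> {RV P >-> R}.
Hypothesis s_moments : forall i, finite_moments P (fun w => (s i w)%:C%C).
Hypothesis s_indep : independent_rvs P (fun i w => s i w).
Implicit Types (c : nat -> R[i]) (r : seq nat).

Definition moment i e : R[i] := cexpectation P (fun w => (s i w)%:C%C ^+ e).

Definition weighted_sum c r (w : T) : R[i] := \sum_(i <- r) c i * (s i w)%:C%C.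

Definition star_power c r (k l : nat) (w : T) : R[i] :=
  weighted_sum c r w ^+ k * ((weighted_sum c r w)^*)%C ^+ l.

Definition star_moment c r k l : R[i] := cexpectation P (star_power c r k l).

Let F i := sigma_of_rv (s i).

Let F_measurable i E : F i E -> measurable E.
Proof.
by case=> B mB <-; rewrite setTI -[_ @^-1` _]setTI; exact: measurable_funP.
Qed.

Let adapted_power i e : adapted (F i) (fun w => (s i w)%:C%C ^+ e).
Proof.
move=> b B mB; exists ((fun x : R => cpart b (x%:C%C ^+ e)) @^-1` B).
  rewrite -[_ @^-1` _]setTI; move: B mB.
  suff : measurable_fun [set: R] (fun x : R => cpart b (x%:C%C ^+ e)).
    by move=> mf B mB; exact: mf.
  under eq_fun do rewrite -rmorphXn /=.
  by case: b => /=; [exact: measurable_cst|exact: measurable_funX].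
by rewrite setTI.
Qed.

Lemma finite_moments_weighted_sum c r : finite_moments P (weighted_sum c r).
Proof.
apply: finite_moments_sum => i; apply: finite_momentsM => //.
exact: finite_moments_cst.
Qed.

Lemma finite_moments_star_power c r k l : finite_moments P (star_power c r k l).
Proof.
apply: finite_momentsM; first exact/finite_momentsX/finite_moments_weighted_sum.
apply: finite_momentsX; apply: finite_moments_conj.
exact: finite_moments_weighted_sum.
Qed.

Lemma star_power_perm c r r' k l : perm_eq r r' ->
  star_power c r k l = star_power c r' k l.
Proof.
move=> rr'; apply/funext => w; rewrite /star_power.
by have -> : weighted_sum c r w = weighted_sum c r' w by exact: perm_big.
Qed.

Definition expansion_coef c i k l (p : nat * nat) : R[i] :=
  ('C(k, p.1) * 'C(l, p.2))%:R * (c i ^+ p.1 * (c i)^*%C ^+ p.2).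

Let star_power_cons c i r k l e w :
  (s i w)%:C%C ^+ e * star_power c (i :: r) k l w =
  \sum_(p : 'I_k.+2 * 'I_l.+2) expansion_coef c i k l (p.1 : nat, p.2 : nat) *
    ((s i w)%:C%C ^+ (e + p.1 + p.2) * star_power c r (k - p.1) (l - p.2) w).
Proof.
rewrite /star_power /weighted_sum big_cons; set V := \sum_(j <- r) _.
have -> : ((c i * (s i w)%:C + V)^* = (c i)^* * (s i w)%:C + V^*)%C.
  by rewrite rmorphD rmorphM; congr (_ * _ + _); exact: conjc_real.
rewrite expand_two_powers big_distrr /=; apply: eq_bigr => p _.
by rewrite /expansion_coef/= !exprMn !exprD; ring.
Qed.

Let decoupled_star_power c r k l : uniq r ->
  decoupled P F r (star_power c r k l).
Proof.
elim: r k l => [k l _|i r IH k l /= /andP[ir ur]].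
  rewrite (_ : star_power _ _ _ _ = fun=> 0 ^+ k * (0^*)%C ^+ l).
    exact: decoupled_cst.
  by apply/funext => w; rewrite /star_power /weighted_sum big_nil.
rewrite (_ : star_power _ _ _ _ = fun w =>
   (s i w)%:C%C ^+ 0 * star_power c (i :: r) k l w); last first.
  by apply/funext => w; rewrite mul1r.
under eq_fun do rewrite star_power_cons.
apply: decoupled_sum => // p; apply: decoupledZ => //.
have [|//] := decoupled_cons F_measurable s_indep ir
  (IH (k - p.1)%N (l - p.2)%N ur) _ (adapted_power i (0 + p.1 + p.2)).
exact: finite_momentsX.
Qed.

(** The variable [s i] is decoupled from the remaining weighted sum, so the
    expectation of each term of the binomial expansion factors. *)
Lemma star_moment_cons c i r k l e : uniq (i :: r) ->
  cexpectation P (fun w => (s i w)%:C%C ^+ e * star_power c (i :: r) k l w) =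
  \sum_(p : 'I_k.+2 * 'I_l.+2) expansion_coef c i k l (p.1 : nat, p.2 : nat) *
    (moment i (e + p.1 + p.2) * star_moment c r (k - p.1) (l - p.2)).
Proof.
move=> /= /andP[ir ur]; under eq_fun do rewrite star_power_cons.
have fsp (p : 'I_k.+2 * 'I_l.+2) : finite_moments P (fun w =>
   (s i w)%:C%C ^+ (e + p.1 + p.2) * star_power c r (k - p.1) (l - p.2) w).
  apply: finite_momentsM; first exact: finite_momentsX.
  exact: finite_moments_star_power.
rewrite cexpectation_sum => [|p]; last first.
  by apply: finite_momentsM; [exact: finite_moments_cst|exact: fsp].
apply: eq_bigr => p _; rewrite cexpectationZ; last exact: fsp.
congr (_ * _).
have [|//] := decoupled_cons F_measurable s_indep ir
  (decoupled_star_power c (k - p.1) (l - p.2) ur) _ (adapted_power i (e + p.1 + p.2)).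
exact: finite_momentsX.
Qed.

End WeightedSums.

(** * Approximate Gaussian integration by parts *)

Section Estimates.
Context d (T : measurableType d) (R : realType) (P : probability T R).
Variable s : nat -> {RV P >-> R}.
Hypothesis s_moments : forall i, finite_moments P (fun w => (s i w)%:C%C).
Hypothesis s_indep : independent_rvs P (fun i w => s i w).
Hypothesis s_mean0 : forall i, moment s i 1 = 0.
Hypothesis s_var1 : forall i, moment s i 2 = 1.
Variable M : nat -> R[i].
Hypothesis s_bounded : forall i e, `|moment s i e| <= M e.
Implicit Types (c : nat -> R[i]) (r : seq nat) (h : R[i]).

Let M_ge0 e : 0 <= M e.
Proof. exact: le_trans (normr_ge0 _) (s_bounded 0 e). Qed.

(** A term of the expansion with [a + b >= 2] contains at least two factors
    [c i], hence is of order [h ^+ 2], and involves a mixed moment of the remaining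
    sum of degree smaller than [k + l]. *)
Lemma star_moment_linear (K : nat -> nat -> R[i]) e k l :
  (forall p q, 0 <= K p q) ->
  exists2 D : R[i], 0 <= D & forall h c i r, 0 <= h <= 1 -> `|c i| <= h ->
    uniq (i :: r) ->
    (forall p q, (p + q < k + l)%N -> `|star_moment s c r p q| <= K p q) ->
    `|cexpectation P (fun w => (s i w)%:C%C ^+ e * star_power s c (i :: r) k l w) -
      (star_moment s c r k l * moment s i e +
       (k%:R * c i * star_moment s c r k.-1 l +
        l%:R * (c i)^*%C * star_moment s c r k l.-1) * moment s i e.+1)|
    <= D * h ^+ 2.
Proof.
move=> K0.
pose t (p : 'I_k.+2 * 'I_l.+2) : R[i] :=
  ('C(k, p.1) * 'C(l, p.2))%:R * (M (e + p.1 + p.2) * K (k - p.1)%N (l - p.2)%N).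
have t0 p : 0 <= t p by rewrite mulr_ge0// mulr_ge0.
exists (\sum_p t p); first exact: sumr_ge0.
move=> h c i r /andP[h0 h1] ch uir hK.
have c0 : `|c i| <= 1 by exact: le_trans ch h1.
rewrite star_moment_cons//.
(* these indices carry the constant and linear terms *)
pose p00 : 'I_k.+2 * 'I_l.+2 := (ord0, ord0).
pose p10 : 'I_k.+2 * 'I_l.+2 := (Ordinal (isT : (1 < k.+2)%N), ord0).
pose p01 : 'I_k.+2 * 'I_l.+2 := (ord0, Ordinal (isT : (1 < l.+2)%N)).
rewrite (bigD1 p00)//= (bigD1 p10)//= (bigD1 p01)//=.
rewrite /expansion_coef/= !bin0 !bin1 !subn0 !subn1 !addn0 !addn1.
set S := \sum_(p | _) _.
rewrite [X in `|X|](_ : _ = S); last by ring.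
rewrite mulr_suml (le_trans (ler_norm_sum _ _ _))//.
rewrite [leRHS](bigID (fun p => (p != p00) && (p != p10) && (p != p01)))/=.
rewrite ler_wpDr//; first by apply: sumr_ge0 => p _; rewrite mulr_ge0// exprn_ge0.
apply: ler_sum => -[a b] /andP[/andP[]]; rewrite !xpair_eqE -!val_eqE /= => ab0 ab1 ab2.
have ab : (2 <= a + b)%N.
  move: ab0 ab1 ab2; case: (nat_of_ord a) (nat_of_ord b) => [|[|?]] [|[|?]]//=;
    by rewrite ?addnS.
rewrite /t/= !normrM normr_nat.
have [ka|ka] := ltnP k a; first by rewrite bin_small// !mul0n !mul0r.
have [lb|lb] := ltnP l b; first by rewrite (bin_small lb) !muln0 !mul0r.
rewrite -!mulrA; apply: ler_wpM2l => //.
rewrite [leLHS](_ : _ = `|moment s i (e + a + b)| *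
  `|star_moment s c r (k - a) (l - b)| * (`|c i| ^+ (a + b))); last first.
  by rewrite !normrX norm_conjc exprD; ring.
rewrite mulrA ler_pM ?mulr_ge0//.
  by rewrite ler_pM// hK//; lia.
apply: (@le_trans _ _ (`|c i| ^+ 2)); first exact: ler_wiXn2l.
by rewrite lerXn2r// nnegrE.
Qed.

Lemma star_moment_perm c r r' k l : perm_eq r r' ->
  star_moment s c r k l = star_moment s c r' k l.
Proof. by move=> rr'; rewrite /star_moment (star_power_perm s c k l rr'). Qed.

Lemma star_moment_nil c k l : star_moment s c [::] k l = 0 ^+ k * 0 ^+ l.
Proof.
rewrite /star_moment (_ : star_power _ _ _ _ _ = fun=> 0 ^+ k * 0 ^+ l).
  exact: cexpectation_cst.
by apply/funext => w; rewrite /star_power /weighted_sum big_nil conjc0.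
Qed.

(** By induction on the degree. The summands are added one at a time: since they
    are centered, each addition changes the moment by [O(h ^+ 2)], and there are
    at most [h ^- 2] of them. *)
Lemma star_moment_bounded : exists K : nat -> nat -> R[i],
  (forall p q, 0 <= K p q) /\
  forall h c r, 0 <= h <= 1 -> (forall i, i \in r -> `|c i| <= h) -> uniq r ->
    (size r)%:R * h ^+ 2 <= 1 -> forall p q, `|star_moment s c r p q| <= K p q.
Proof.
suff /choice[K_ HK] : forall N, exists K : nat -> nat -> R[i],
    (forall p q, 0 <= K p q) /\
    forall h c r, 0 <= h <= 1 -> (forall i, i \in r -> `|c i| <= h) -> uniq r ->
      (size r)%:R * h ^+ 2 <= 1 ->
      forall p q, (p + q < N)%N -> `|star_moment s c r p q| <= K p q.
  exists (fun p q => K_ (p + q).+1 p q); split=> [p q|h c r h01 ch ur rh p q].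
    by have [K0 _] := HK (p + q).+1; exact: K0.
  by have [_ H] := HK (p + q).+1; exact: (H h).
elim=> [|N [K [K0 HK]]]; first by exists (fun _ _ => 0); split.
have /choice[D HD] : forall p : nat * nat, exists D : R[i], 0 <= D /\
    forall h c i r, 0 <= h <= 1 -> `|c i| <= h -> uniq (i :: r) ->
      (forall p' q', (p' + q' < p.1 + p.2)%N ->
         `|star_moment s c r p' q'| <= K p' q') ->
      `|star_moment s c (i :: r) p.1 p.2 - star_moment s c r p.1 p.2| <= D * h ^+ 2.
  move=> [k l]; have [D D0 HD] := @star_moment_linear K 0 k l K0.
  exists D; split=> // h c i r h01 ch ur hK.
  have := HD h c i r h01 ch ur hK; rewrite s_mean0 mulr0 addr0.
  rewrite {1}/moment cexpectation_cst mulr1; apply: le_trans.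
  rewrite le_eqVlt; apply/orP; left; apply/eqP; congr (`|_ - _|).
  by congr (cexpectation P _); apply/funext => w; rewrite mul1r.
exists (fun p q => if (p + q < N)%N then K p q else 1 + D (p, q)).
split=> [p q|].
  by case: ifP => // _; rewrite addr_ge0//; have [] := HD (p, q).
move=> h c r h01 ch ur rh p q; rewrite ltnS leq_eqVlt => /predU1P[pqN|pqN]; last first.
  by rewrite pqN; exact: (HK h).
rewrite pqN ltnn; have [D0 HDpq] := HD (p, q).
have h0 : 0 <= h by case/andP: h01.
suff : `|star_moment s c r p q| <= 1 + (size r)%:R * (D (p, q) * h ^+ 2).
  move/le_trans; apply; rewrite lerD2l mulrCA -[leRHS]mulr1.
  by rewrite ler_wpM2l.
elim: r ch ur rh => [_ _ _|i r IH ch ur rh].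
  rewrite star_moment_nil mul0r addr0 normrM !normrX normr0.
  by rewrite mulr_ile1// ?exprn_ge0// exprn_ile1.
have ch' j : j \in r -> `|c j| <= h by move=> jr; apply: ch; rewrite inE jr orbT.
have rh' : (size r)%:R * h ^+ 2 <= 1.
  apply: le_trans rh; rewrite ler_wpM2r ?exprn_ge0// ler_nat /=; lia.
have ur' : uniq r by case/andP: ur.
have step := HDpq h c i r h01 (ch i (mem_head _ _)) ur.
rewrite -[star_moment _ _ _ _ _](subrK (star_moment s c r p q)).
rewrite (le_trans (ler_normD _ _))// -natr1 mulrDl mul1r addrA addrC.
rewrite lerD//; last exact: IH.
by apply: step => p' q' /=; rewrite pqN => pq'; exact: (HK h).
Qed.

(** Gaussian integration by parts, up to an error. One unstarred factor is
    replaced by its sum, and each summand [s i] is integrated against the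
    first-order part of the remaining factors. The pairings of two unstarred
    factors add up to a multiple of the sum of the squared weights. *)
Lemma star_moment_stein k l :
  exists2 D : R[i], 0 <= D & forall h c r, 0 <= h <= 1 ->
    (forall i, i \in r -> `|c i| = h) -> uniq r -> (size r)%:R * h ^+ 2 = 1 ->
    \sum_(i <- r) c i ^+ 2 = 0 ->
    `|star_moment s c r k.+1 l - l%:R * star_moment s c r k l.-1| <= D * h.
Proof.
have [K [K0 HK]] := star_moment_bounded.
have [D1 D10 HD1] := @star_moment_linear K 1 k l K0.
have [D2 D20 HD2] := @star_moment_linear K 0 k.-1 l K0.
have [D3 D30 HD3] := @star_moment_linear K 0 k l.-1 K0.
exists (D1 + k%:R * D2 + l%:R * D3); first by rewrite !addr_ge0// mulr_ge0.
move=> h c r h01 ch ur rh c2.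
have h0 : 0 <= h by case/andP: h01.
have h1 : h <= 1 by case/andP: h01.
pose A i := cexpectation P (fun w => (s i w)%:C%C * star_power s c r k l w).
pose X := star_moment s c r k.-1 l; pose Y := star_moment s c r k l.-1.
have sumA : star_moment s c r k.+1 l = \sum_(i <- r) c i * A i.
  have fA i : finite_moments P (fun w => (s i w)%:C%C * star_power s c r k l w).
    by apply: finite_momentsM => //; exact: finite_moments_star_power.
  transitivity (\sum_(i <- r) cexpectation P
      (fun w => c i * ((s i w)%:C%C * star_power s c r k l w))).
    rewrite -cexpectation_sum => [|i]; last first.
      by apply: finite_momentsM => //; exact: finite_moments_cst.
    congr (cexpectation P _); apply/funext => w.
    rewrite /star_power exprS -mulrA {1}/weighted_sum mulr_suml.
    by apply: eq_bigr => i _; rewrite -mulrA.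
  by apply: eq_bigr => i _; rewrite cexpectationZ.
have bnd i : i \in r ->
    `|A i - (k%:R * c i * X + l%:R * (c i)^*%C * Y)| <=
    (D1 + k%:R * D2 + l%:R * D3) * h ^+ 2.
  move=> ir; pose r' := rem i r.
  have rr' : perm_eq r (i :: r') by exact: perm_to_rem.
  have uir' : uniq (i :: r') by rewrite -(perm_uniq rr').
  have ci : `|c i| <= h by rewrite ch.
  have HK' p q : `|star_moment s c r' p q| <= K p q.
    apply: (HK h) => //; [|by case/andP: uir'|].
      by move=> j /mem_rem jr; rewrite ch.
    by rewrite -[leRHS]rh ler_wpM2r ?exprn_ge0// ler_nat (perm_size rr') /=.
  have HDir (D : R[i]) p q (H : `|cexpectation P (fun w => (s i w)%:C%C ^+ 0 *
        star_power s c (i :: r') p q w) -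
      (star_moment s c r' p q * moment s i 0 +
       (p%:R * c i * star_moment s c r' p.-1 q +
        q%:R * (c i)^*%C * star_moment s c r' p q.-1) * moment s i 1)| <= D * h ^+ 2) :
      `|star_moment s c r p q - star_moment s c r' p q| <= D * h ^+ 2.
    move: H; rewrite s_mean0 mulr0 addr0 {1}/moment cexpectation_cst mulr1.
    apply: le_trans; rewrite le_eqVlt; apply/orP; left; apply/eqP; congr (`|_ - _|).
    rewrite (star_moment_perm _ _ _ rr').
    by congr (cexpectation P _); apply/funext => w; rewrite mul1r.
  have e1 := HD1 h c i r' h01 ci uir' (fun p q _ => HK' p q).
  have e2 := HDir _ _ _ (HD2 h c i r' h01 ci uir' (fun p q _ => HK' p q)).
  have e3 := HDir _ _ _ (HD3 h c i r' h01 ci uir' (fun p q _ => HK' p q)).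
  move: e1; rewrite s_mean0 s_var1 mulr0 add0r mulr1.
  under eq_fun do rewrite expr1 -(star_power_perm s c k l rr').
  rewrite -/(A i) => e1.
  set X' := star_moment s c r' k.-1 l in e1 e2.
  set Y' := star_moment s c r' k l.-1 in e1 e3.
  rewrite (_ : A i - _ = (A i - (k%:R * c i * X' + l%:R * (c i)^*%C * Y')) -
    k%:R * c i * (X - X') - l%:R * (c i)^*%C * (Y - Y')); last by ring.
  rewrite (le_trans (ler_normB _ _))// [leRHS]mulrDl lerD//.
    rewrite (le_trans (ler_normB _ _))// [leRHS]mulrDl lerD//.
    rewrite !normrM normr_nat -!mulrA ler_wpM2l// -[leRHS]mul1r.
    by rewrite ler_pM// (le_trans ci).
  rewrite !normrM normr_nat norm_conjc -!mulrA ler_wpM2l// -[leRHS]mul1r.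
  by rewrite ler_pM// (le_trans ci).
have lY : l%:R * Y = \sum_(i <- r) c i * (k%:R * c i * X + l%:R * (c i)^*%C * Y).
  transitivity (k%:R * X * (\sum_(i <- r) c i ^+ 2) +
                l%:R * Y * \sum_(i <- r) `|c i| ^+ 2).
    rewrite c2 mulr0 add0r (eq_big_seq (fun=> h ^+ 2)); last first.
      by move=> i /ch ->.
    by rewrite big_const_seq count_predT iter_addr addr0 -[h ^+ 2 *+ _]mulr_natl rh mulr1.
  rewrite !mulr_sumr -big_split; apply: eq_bigr => i _ /=.
  by rewrite -mul_conjc_norm; ring.
rewrite lY sumA -sumrB big_seq (le_trans (ler_norm_sum _ _ _))//.
apply: (@le_trans _ _ (\sum_(i <- r) h * ((D1 + k%:R * D2 + l%:R * D3) * h ^+ 2))).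
  rewrite [leRHS]big_seq; apply: ler_sum => i ir.
  by rewrite -mulrBr normrM ch// ler_wpM2l// bnd.
rewrite big_const_seq count_predT iter_addr addr0 -[leLHS]mulr_natl.
rewrite [leLHS](_ : _ = ((size r)%:R * h ^+ 2) * ((D1 + k%:R * D2 + l%:R * D3) * h)).
  by rewrite rh mul1r.
by ring.
Qed.

(** The recursion [m k.+1 l = l * m k l.-1] with [m 0 0 = 1] and [m 0 l.+1 = 0]
    has the solution [m k l = (k == l) * k`!]; the errors of finitely many steps
    add up. *)
Lemma star_moment_limit k l :
  exists2 D : R[i], 0 <= D & forall h c r, 0 <= h <= 1 ->
    (forall i, i \in r -> `|c i| = h) -> uniq r -> (size r)%:R * h ^+ 2 = 1 ->
    \sum_(i <- r) c i ^+ 2 = 0 ->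
    `|star_moment s c r k l - ((k == l) * k`!)%:R| <= D * h.
Proof.
elim: k l => [|k IH] l.
  case: l => [|l].
    exists 0 => // h c r _ _ _ _ _; rewrite mul0r.
    rewrite /star_moment (_ : star_power _ _ _ _ _ = fun=> 1).
      by rewrite cexpectation_cst subrr normr0.
    by apply/funext => w; rewrite /star_power !expr0 mulr1.
  have [D D0 HD] := star_moment_stein l 0; exists D => // h c r h01 ch ur rh c2.
  (* conjugating the weights exchanges the two kinds of factors *)
  have -> : star_moment s c r 0 l.+1 = star_moment s (fun i => (c i)^*%C) r l.+1 0.
    congr (cexpectation P _); apply/funext => w.
    rewrite /star_power !expr0 mul1r mulr1; congr (_ ^+ _).
    rewrite /weighted_sum rmorph_sum; apply: eq_bigr => i _.
    by rewrite rmorphM; congr (_ * _); exact: conjc_real.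
  have := HD h (fun i => (c i)^*%C) r h01; rewrite mul0r mul0n; apply=> //.
    by move=> i ir; rewrite norm_conjc ch.
  transitivity ((\sum_(i <- r) c i ^+ 2)^*)%C; last by rewrite c2 conjc0.
  by rewrite rmorph_sum; apply: eq_bigr => i _; rewrite rmorphXn.
have [D D0 HD] := star_moment_stein k l.
have [D' D'0 HD'] := IH l.-1.
exists (D + l%:R * D'); first by rewrite addr_ge0// mulr_ge0.
move=> h c r h01 ch ur rh c2.
have h0 : 0 <= h by case/andP: h01.
have e1 := HD h c r h01 ch ur rh c2; have e2 := HD' h c r h01 ch ur rh c2.
have -> : ((k.+1 == l) * k.+1`!)%:R = l%:R * ((k == l.-1) * k`!)%:R :> R[i].
  case: l {IH HD HD' e1 e2} => [|l]; first by rewrite mul0r mul0n.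
  rewrite -natrM eqSS /=; have [->|_] := eqVneq k l; first by rewrite !mul1n factS.
  by rewrite !mul0n muln0.
rewrite -[star_moment _ _ _ _ _](subrK (l%:R * star_moment s c r k l.-1)).
rewrite -addrA -mulrBr (le_trans (ler_normD _ _))// mulrDl lerD//.
by rewrite normrM normr_nat -mulrA ler_wpM2l.
Qed.

End Estimates.

(** * Simultaneous diagonalization of skew-circulant matrices *)

Section Diagonalization.
Context {R : rcfType} (n : nat).
Local Notation C := R[i].

(** A repeated root would be a root of the derivative. *)
Let uniq_simple_roots (r : seq C) :
  (forall z, z \in r -> (\prod_(x <- r) ('X - x%:P))^`().[z] != 0) -> uniq r.
Proof.
elim: r => //= x r IH h; rewrite big_cons in h.
have dz z : (('X - x%:P) * \prod_(x <- r) ('X - x%:P))^`().[z] =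
    (\prod_(x <- r) ('X - x%:P)).[z] + (z - x) * (\prod_(x <- r) ('X - x%:P))^`().[z].
  by rewrite derivM derivXsubC mul1r !hornerE.
apply/andP; split.
  have := h x (mem_head _ _); rewrite dz subrr mul0r addr0.
  by apply: contra => xr; rewrite -rootE root_prod_XsubC.
apply: IH => z zr; have := h z; rewrite inE zr orbT dz => /(_ isT).
have -> : (\prod_(x <- r) ('X - x%:P)).[z] = 0.
  by apply/eqP; rewrite -rootE root_prod_XsubC.
by rewrite add0r mulf_eq0 negb_or => /andP[].
Qed.

Lemma skew_roots : exists z : 'I_n.+1 -> C,
  [/\ injective z, forall t, z t ^+ n.+1 = -1 & forall t, `|z t| = 1].
Proof.
pose p : {poly C} := 'X^(n.+1) + 1%:P.
have sp : size p = n.+2.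
  by rewrite size_polyDl size_polyXn// (leq_ltn_trans (size_polyC_leq1 _)).
have mp : lead_coef p = 1.
  by rewrite lead_coefDl ?lead_coefXn// size_polyXn (leq_ltn_trans (size_polyC_leq1 _)).
have [r pE] := closed_field_poly_normal p; rewrite mp scale1r in pE.
have rp z : z \in r -> z ^+ n.+1 = -1.
  rewrite -root_prod_XsubC -pE rootE !hornerE => /eqP e.
  by apply/eqP; rewrite -addr_eq0 e.
have ur : uniq r.
  apply: uniq_simple_roots => z /rp zn; rewrite -pE derivD derivC addr0 derivXn.
  rewrite hornerMn hornerXn/= -mulr_natr mulf_neq0 ?pnatr_eq0//.
  rewrite expf_eq0; apply/negP => /andP[_ /eqP z0]; move: zn.
  by rewrite z0 expr0n/= => /eqP; rewrite eq_sym oppr_eq0 oner_eq0.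
have sr : size r = n.+1.
  by have := sp; rewrite pE size_prod_XsubC => -[].
have tr (t : 'I_n.+1) : r`_t \in r by rewrite mem_nth// sr.
exists (fun t => r`_t); split=> [t u /eqP|t|t].
- by rewrite nth_uniq ?sr// => /eqP/val_inj.
- exact/rp/tr.
- apply/eqP; rewrite -(@pexpr_eq1 _ _ n.+1)// -normrX (rp _ (tr t)).
  by rewrite normrN1.
Qed.

Variable z : 'I_n.+1 -> C.
Hypothesis z_inj : injective z.
Hypothesis z_root : forall t, z t ^+ n.+1 = -1.
Hypothesis z_norm : forall t, `|z t| = 1.

Let U : 'M[C]_n.+1 := \matrix_(i, t) z t ^+ i.

Let U_unit : U \in unitmx.
Proof.
have -> : U = Vandermonde n.+1 (\row_t z t).
  by apply/matrixP => i t; rewrite !mxE.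
rewrite unitmxE det_Vandermonde unitfE; apply/prodf_neq0 => i _.
apply/prodf_neq0 => j ij; rewrite !mxE subr_eq0.
by apply: contraTneq ij => /z_inj ->; rewrite ltnn.
Qed.

Definition skew_eigenvalue (y : nat -> C) (t : 'I_n.+1) : C :=
  \sum_(m < n.+1) z t ^+ m * y m.

Let modn_sub (i m : nat) : (i < n.+1)%N -> (m < n.+1)%N -> (n.+1 <= i + m)%N ->
  ((i + m) %% n.+1)%N = (i + m - n.+1)%N.
Proof.
by move=> i_lt m_lt nim; rewrite -{1}(subnK nim) modnDr modn_small//; lia.
Qed.

(** The powers of [z t] form an eigenvector: since [z t ^+ n.+1 = -1], wrapping
    around the end of a row produces the sign carried by the entries below the
    diagonal. *)
Let skew_circulant_eigen y : skew_circulant n.+1 y *m U =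
  U *m diag_mx (\row_t skew_eigenvalue y t).
Proof.
apply/matrixP => i t; rewrite mul_mx_diag !mxE /skew_eigenvalue mulr_sumr.
rewrite (reindex_inj (addrI i)); apply: eq_bigr => m _; rewrite !mxE /=.
have [im|im] := ltnP (i + m) n.+1.
  by rewrite modn_small// leq_addr addKn exprD; ring.
have lti := ltn_ord i; have ltm := ltn_ord m.
rewrite modn_sub// ifF; last by apply/negP; lia.
have -> : (n.+1 + (i + m - n.+1) - i = m)%N by lia.
have := exprD (z t) n.+1 (i + m - n.+1).
rewrite subnKC// exprD z_root mulN1r mulrA => ->; ring.
Qed.

(** The same vectors work for the adjoint because [z t] has modulus one: its
    conjugate is its inverse, so summing along a row in decreasing order of the
    exponents yields the conjugate eigenvalue. *)
Let skew_circulant_adj_eigen y : map_mx conjc (skew_circulant n.+1 y)^T *m U =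
  U *m diag_mx (\row_t ((skew_eigenvalue y t)^*)%C).
Proof.
apply/matrixP => i t; rewrite mul_mx_diag !mxE /skew_eigenvalue rmorph_sum mulr_sumr.
have zz : z t * ((z t)^*)%C = 1 by rewrite mul_conjc_norm z_norm expr1n.
have zzX m : z t ^+ m * ((z t)^*)%C ^+ m = 1 by rewrite -exprMn zz expr1n.
rewrite (reindex_inj (inj_comp (addrI i) (@oppr_inj _))); apply: eq_bigr => m _.
rewrite !mxE rmorphM rmorphXn /=.
have lti := ltn_ord i; have ltm := ltn_ord m.
have [m0|m0] := posnP m.
  by rewrite m0 subn0 modnn addn0 modn_small// leqnn subnn expr0 mul1r mulrC.
rewrite [((n.+1 - m) %% _)%N]modn_small; last by lia.
have [mi|im] := leqP m i.
  have -> : ((i + (n.+1 - m)) %% n.+1 = i - m)%N by rewrite modn_sub; lia.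
  rewrite leq_subr subKn// -{2}(subnK mi) exprD -!mulrA (mulrA (z t ^+ m)) zzX.
  by rewrite mul1r mulrC.
rewrite modn_small; last by lia.
rewrite ifF; last by apply/negP; lia.
have -> : (n.+1 + i - (i + (n.+1 - m)) = m)%N by lia.
have := exprD (z t) (i + (n.+1 - m)) m.
have -> : (i + (n.+1 - m) + m = n.+1 + i)%N by lia.
rewrite exprD z_root mulN1r rmorphN => e.
have -> : z t ^+ i = - (z t ^+ (i + (n.+1 - m)) * z t ^+ m) by rewrite -e opprK.
rewrite -{1}[z t ^+ (i + (n.+1 - m))]mulr1 -(zzX m); ring.
Qed.

(** All factors are diagonal in the basis of the columns of [U], whose Vandermonde
    determinant is nonzero because the roots are distinct. *)
Lemma trace_skew_circulant_word (I : Type) (y : I -> nat -> C) (w : seq (I * bool)) :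
  \tr (\prod_(l <- w) (if l.2 then map_mx conjc (skew_circulant n.+1 (y l.1))^T
                       else skew_circulant n.+1 (y l.1))) =
  \sum_(t < n.+1) \prod_(l <- w)
    (if l.2 then ((skew_eigenvalue (y l.1) t)^*)%C else skew_eigenvalue (y l.1) t).
Proof.
pose ev t := \prod_(l <- w)
  (if l.2 then ((skew_eigenvalue (y l.1) t)^*)%C else skew_eigenvalue (y l.1) t).
suff e : \prod_(l <- w) (if l.2 then map_mx conjc (skew_circulant n.+1 (y l.1))^T
     else skew_circulant n.+1 (y l.1)) *m U = U *m diag_mx (\row_t ev t).
  rewrite -[X in \tr X](mulmxK U_unit) e mxtrace_mulC mulmxA mulVmx// mul1mx.
  by rewrite mxtrace_diag; apply: eq_bigr => t _; rewrite mxE.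
rewrite /ev; elim: w {ev} => [|[j b] w IH].
  rewrite big_nil mul1mx (_ : diag_mx _ = 1%:M) ?mulmx1//.
  by apply/matrixP => i t; rewrite !mxE big_nil.
rewrite big_cons -mulmxA IH mulmxA.
have -> : (if b then map_mx conjc (skew_circulant n.+1 (y j))^T
     else skew_circulant n.+1 (y j)) *m U = U *m diag_mx (\row_t
   (if b then ((skew_eigenvalue (y j) t)^*)%C else skew_eigenvalue (y j) t)).
  by case: b; [exact: skew_circulant_adj_eigen|exact: skew_circulant_eigen].
rewrite -mulmxA mulmx_diag; congr (_ *m diag_mx _).
by apply/rowP => t; rewrite !mxE big_cons.
Qed.

End Diagonalization.

(** * Moments of the normal distribution of variance one half *)

Section NormalIntegral.
Context {R : realType} (m sigma : R).
Local Notation mu := (@lebesgue_measure R).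
Local Notation nu := (normal_prob m sigma).
Local Notation pdf := (normal_pdf m sigma).

(** The normal density agrees almost everywhere with the Radon-Nikodym derivative
    of the normal probability. *)
Lemma ge0_integral_normal_prob (f : R -> \bar R) :
  (forall x, (0 <= f x)%E) -> measurable_fun [set: R] f ->
  (\int[nu]_x f x = \int[mu]_x (f x * (pdf x)%:E))%E.
Proof.
move=> f0 mf; have dom : nu `<< mu := normal_prob_dominates m sigma.
rewrite -(Radon_Nikodym_SigmaFinite.change_of_variables dom)//.
have ig := Radon_Nikodym_SigmaFinite.f_integrable dom.
have mpdf : measurable_fun [set: R] (EFin \o pdf).
  by apply/measurable_EFinP; apply: measurable_normal_pdf.
apply: ae_eq_integral => //.
- by apply: emeasurable_funM => //; exact: measurable_int ig.
- by apply: emeasurable_funM.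
- apply: ae_eqe_mul2l; apply: integral_ae_eq => // E _ mE.
  by rewrite -Radon_Nikodym_SigmaFinite.f_integral.
Qed.

Lemma Rintegral_normal_prob (f : R -> R) : measurable_fun [set: R] f ->
  \int[nu]_x f x = \int[mu]_x (f x * pdf x).
Proof.
move=> mf; have mEf : measurable_fun [set: R] (EFin \o f) by exact/measurable_EFinP.
rewrite /Rintegral [in LHS]integralE [in RHS]integralE; congr fine.
rewrite !ge0_integral_normal_prob//; [|exact: measurable_funeneg|exact: measurable_funepos].
congr (_ - _)%E; apply: eq_integral => x _ /=.
  by rewrite !funeposE /= -!EFin_max -EFinM maxr_pMl ?normal_pdf_ge0// mul0r.
by rewrite !funenegE /= -!EFin_max -EFinM maxr_pMl ?normal_pdf_ge0// mul0r mulNr.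
Qed.

End NormalIntegral.

Section HalfGaussianMoments.
Context {R : realType}.
Local Notation mu := (@lebesgue_measure R).
Local Notation sigma := (Num.sqrt (2^-1 : R)).
Local Notation pdf := (normal_pdf 0 sigma).

Let sigma_neq0 : sigma != 0.
Proof. by rewrite gt_eqF// sqrtr_gt0 invr_gt0. Qed.

Let pdfE x : pdf x = normal_peak sigma * expR (- x ^+ 2).
Proof.
rewrite normal_pdfE// /normal_fun subr0 sqr_sqrtr ?invr_ge0//.
by rewrite -[2^-1 *+ 2]mulr_natr mulVf ?divr1// pnatr_eq0.
Qed.

(** Half of the Gaussian decay absorbs any power: [t ^+ n <= n`! * expR t] for
    [t = x ^+ 2 / 2]; the term [1] of the constant covers [`|x| <= 1]. *)
Let pow_le_exp n (x : R) : `|x| ^+ n <= (1 + 2 ^+ n * n`!%:R) * expR (x ^+ 2 / 2).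
Proof.
have t0 : 0 <= x ^+ 2 / 2 by rewrite mulr_ge0// sqr_ge0.
have e1 : 1 <= expR (x ^+ 2 / 2) by rewrite -[leLHS]expR0 ler_expR.
have tn : (x ^+ 2 / 2) ^+ n <= n`!%:R * expR (x ^+ 2 / 2).
  case: n => [|n]; first by rewrite expr0 fact0 mul1r.
  rewrite [leRHS]mulrC -ler_pdivrMr ?ltr0n ?fact_gt0//.
  by apply: le_trans (expR_ge1Dxn n t0); rewrite lerDr.
rewrite mulrDl mul1r; have [x1|x1] := leP `|x| 1.
  rewrite (@le_trans _ _ 1)//; first by rewrite exprn_ile1.
  by rewrite (le_trans e1)// lerDl !mulr_ge0// ?exprn_ge0// expR_ge0.
apply: (@le_trans _ _ (2 ^+ n * (x ^+ 2 / 2) ^+ n)).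
  rewrite -exprMn mulrCA divff// mulr1 -[x ^+ 2]real_normK ?num_real//.
  by rewrite -exprM ler_weXn2l// ?ltW// leq_pmull.
rewrite -mulrA (le_trans _ (_ : 2 ^+ n * (n`!%:R * expR (x ^+ 2 / 2)) <= _))//.
  by rewrite ler_wpM2l// exprn_ge0.
by rewrite lerDr expR_ge0.
Qed.

(** The remaining half, [expR (- (x ^+ 2 / 2))], is the standard normal density up
    to a constant, and dominates [x ^+ n * pdf x] both for integrability and at
    infinity. *)
Let tail n (x : R) : `|x ^+ n * pdf x| <=
  (normal_peak sigma * (1 + 2 ^+ n * n`!%:R)) * expR (- (x ^+ 2 / 2)).
Proof.
rewrite pdfE normrM normrX [X in _ * X]ger0_norm; last first.
  by rewrite mulr_ge0 ?expR_ge0// normal_peak_ge0.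
rewrite mulrCA -mulrA ler_wpM2l ?normal_peak_ge0//.
rewrite (_ : - x ^+ 2 = - (x ^+ 2 / 2) + - (x ^+ 2 / 2)); last by field.
by rewrite expRD mulrA ler_wpM2r ?expR_ge0// expRN ler_pdivrMr ?expR_gt0// pow_le_exp.
Qed.

Let integrable_pow_pdf n :
  mu.-integrable [set: R] (EFin \o (fun x => x ^+ n * pdf x)).
Proof.
have i1 := @integrable_normal_pdf R 0 1.
pose K := normal_peak sigma * (1 + 2 ^+ n * n`!%:R) / normal_peak 1.
have : mu.-integrable [set: R] (fun x => K%:E * (normal_pdf 0 1 x)%:E)%E.
  exact: integrableZl.
apply: le_integrable => //.
  apply/measurable_EFinP; apply: measurable_funM; first exact: measurable_funX.
  exact: measurable_normal_pdf.
move=> x _ /=; rewrite lee_fin.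
apply: le_trans (tail n x) _; apply: le_trans (ler_norm _).
rewrite /K normal_pdfE ?oner_neq0// /normal_fun subr0 expr1n -!mulrA ler_wpM2l ?normal_peak_ge0//.
rewrite ler_wpM2l ?addr_ge0// ?mulr_ge0// ?exprn_ge0//.
by rewrite mulKf ?mulNr ?expr2 ?mulrA// gt_eqF// normal_peak_gt0// oner_neq0.
Qed.

Lemma gauss_half_finite_moments :
  finite_moments (@gauss_half R) (fun x => (x%:C)%C).
Proof.
apply: finite_moments_real => [|n]; first exact: measurable_id.
rewrite unlock (ge0_integral_normal_prob _ _ (f := fun x => (`|x| ^+ n)%:E)) //; last first.
  by apply/measurable_EFinP; apply: measurable_funX; exact: normr_measurable.
have /integrableP[_] := integrable_pow_pdf n; congr (_ < _)%E.
apply: eq_integral => x _ /=; rewrite normrM normrX [X in _ * X]ger0_norm//.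
exact: normal_pdf_ge0.
Qed.

Definition half_moment n : R := \int[@gauss_half R]_x (x ^+ n).

Let is_derive_pow_pdf n (x : R) : is_derive x 1 (fun x => x ^+ n * pdf x)
  (n%:R * (x ^+ n.-1 * pdf x) - 2 * (x ^+ n.+1 * pdf x)).
Proof.
have dX k : is_derive x (1 : R) (fun y : R => y ^+ k) (k%:R * x ^+ k.-1).
  have := is_deriveX k (is_derive_id x (1 : R)); rewrite exprfctE.
  by move=> /is_derive_eq; apply; rewrite /= [_ *: _]mulr1.
have dE : is_derive x (1 : R) (fun y : R => expR (- y ^+ 2))
    (- (2 * x) * expR (- x ^+ 2)).
  have dN : is_derive x (1 : R) (fun y : R => - y ^+ 2) (- (2 * x)).
    by have := is_deriveN (dX 2%N); rewrite expr1.
  by have := @is_derive1_comp _ expR (fun y : R => - y ^+ 2) x _ _ (is_derive_expR _) dN;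
    rewrite mulrC.
have := is_deriveM (dX n) (is_deriveZ (normal_peak sigma) dE).
rewrite (_ : (_ * _) = fun y => y ^+ n * pdf y); last first.
  by apply/funext => y; rewrite pdfE.
move=> /is_derive_eq; apply; rewrite /= pdfE /GRing.scale /= [x ^+ n.+1]exprS; ring.
Qed.

Let continuous_pow_pdf n : continuous (fun x : R => x ^+ n * pdf x).
Proof.
move=> x; have [dF _] := is_derive_pow_pdf n x.
exact/differentiable_continuous/derivable1_diffP.
Qed.

(** The derivative [f] of [F x = x ^+ n * pdf x] has integral zero over the line,
    as the limit of its integrals [F N.+1 - F (- N.+1)] over growing
    intervals. *)
Lemma half_momentS n : 2 * half_moment n.+1 = n%:R * half_moment n.-1.
Proof.
pose F (x : R) := x ^+ n * pdf x.
pose f (x : R) := n%:R * (x ^+ n.-1 * pdf x) - 2 * (x ^+ n.+1 * pdf x).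
have hE k : half_moment k = \int[mu]_x (x ^+ k * pdf x).
  by rewrite /half_moment Rintegral_normal_prob//; exact: measurable_funX.
have iZ (c : R) k : mu.-integrable [set: R] (EFin \o (fun x => c * (x ^+ k * pdf x))).
  rewrite (_ : _ \o _ = (fun x => c%:E * (EFin \o (fun x => x ^+ k * pdf x)%R) x)%E)//.
  by apply: integrableZl => //; exact: integrable_pow_pdf.
have cf : continuous f.
  by move=> x; apply: cvgB; apply: cvgM;
    [exact: cvg_cst|exact: continuous_pow_pdf|exact: cvg_cst|exact: continuous_pow_pdf].
have cF : continuous F by exact: continuous_pow_pdf.
have if_ : mu.-integrable [set: R] (EFin \o f).
  rewrite (_ : _ \o _ = (EFin \o (fun x => n%:R * (x ^+ n.-1 * pdf x))%R) \-
    (EFin \o (fun x => 2 * (x ^+ n.+1 * pdf x))%R))%E//.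
  by apply: integrableB => //; exact: iZ.
suff f0 : \int[mu]_x f x = 0.
  move: f0; rewrite /f RintegralB//; [|exact: iZ..].
  rewrite !RintegralZl//; [|exact: integrable_pow_pdf..].
  by rewrite !hE => /eqP; rewrite subr_eq0 => /eqP ->.
have mf : measurable_fun [set: R] f by exact: continuous_measurable_fun.
pose I (N : nat) : set R := `[- N.+1%:R, N.+1%:R]%classic.
have mI N : measurable (I N) by exact: measurable_itv.
have c1 : (fun N => \int[mu]_x (\1_(I N) x * f x)) @ \oo --> \int[mu]_x f x.
  apply: (@Rintegral_dominated_cvg _ (measurableTypeR R) R mu
    (fun N x => \1_(I N) x * f x) f (fun x => `|f x|)) => //.
  - by move=> N; apply: measurable_funM => //; apply: measurable_indic; exact: measurable_itv.
  - move=> x; apply: cvg_near_cst; near=> N.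
    rewrite indicE mem_set ?mul1r//= /I /= in_itv/= -ler_norml.
    near: N; exists (Num.truncn `|x|) => // N /= xN.
    rewrite (le_trans (ltW (truncnS_gt _)))// ler_nat.
    by rewrite ltnS.
  - exact: integrable_abse if_.
  - move=> N x; rewrite normrM ler_piMl// indicE.
    by case: (_ \in _); rewrite ?normr1 ?normr0.
have FTC N : \int[mu]_x (\1_(I N) x * f x) = F N.+1%:R - F (- N.+1%:R).
  have -> : \int[mu]_x (\1_(I N) x * f x) = \int[mu]_(x in I N) f x.
    rewrite [RHS]Rintegral_mkcond; apply: eq_Rintegral => x _.
    by rewrite patchE indicE; case: ifP => _; rewrite ?mul1r ?mul0r.
  rewrite /Rintegral /I (@continuous_FTC2 _ f F)//.
  - by rewrite (@lt_trans _ _ 0)// ?oppr_lt0.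
  - exact: continuous_subspaceT.
  - split.
    + by move=> x _; have [] := is_derive_pow_pdf n x.
    + exact/cvg_at_right_filter/cF.
    + exact/cvg_at_left_filter/cF.
  - by move=> x _; rewrite derive1E; have [_ ->] := is_derive_pow_pdf n x.
have c2 : (fun N => \int[mu]_x (\1_(I N) x * f x)) @ \oo --> (0 : R).
  pose K := normal_peak sigma * (1 + 2 ^+ n * n`!%:R).
  have K0 : 0 <= K.
    by rewrite mulr_ge0 ?normal_peak_ge0// addr_ge0// mulr_ge0// exprn_ge0.
  have bF N (x : R) : `|x| = N.+1%:R -> `|F x| <= K * (2 * harmonic N).
    move=> xN; apply: (le_trans (tail n x)); rewrite -/K ler_wpM2l//.
    rewrite expRN -[harmonic N]/(N.+1%:R^-1) -[2 in leRHS]invrK -invfM.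
    rewrite lef_pV2 ?posrE ?expR_gt0// ?mulr_gt0// ?invr_gt0//.
    apply: le_trans (expR_ge1Dx _).
    rewrite -[x ^+ 2]real_normK ?num_real// xN.
    rewrite [leLHS]mulrC (le_trans _ (_ : N.+1%:R ^+ 2 / 2 <= _))//; last by rewrite lerDr.
    by rewrite ler_wpM2r// expr2 ler_peMr// ler1n.
  apply/cvgr0Pnorm_le => e e0.
  have /cvgr0Pnorm_le := @cvg_harmonic R.
  have e' : 0 < e / (4 * K + 1) by rewrite divr_gt0// ltr_wpDl// mulr_ge0.
  move=> /(_ _ e'); apply: filterS => N; rewrite ger0_norm ?harmonic_ge0// => hN.
  rewrite FTC (le_trans (ler_normB _ _))//.
  rewrite (le_trans (lerD (bF N _ _) (bF N _ _)))//.
  + by rewrite ger0_norm.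
  + by rewrite normrN ger0_norm.
  rewrite (_ : _ + _ = (4 * K) * harmonic N); last by ring.
  move: hN; rewrite ler_pdivlMr; last by rewrite ltr_wpDl// mulr_ge0.
  by apply: le_trans; rewrite mulrC ler_wpM2l ?harmonic_ge0// lerDl.
by rewrite -(cvg_lim (@Rhausdorff R) c1); exact: cvg_lim c2.
Unshelve. all: by end_near. Qed.

End HalfGaussianMoments.

(** * Moments of the standard complex Gaussian variable *)

Section SteinSums.
Context {A : comNzRingType} (G : nat -> A) (x y : A).
Implicit Types (W : nat -> nat -> A) (k l : nat).

(** If [G m] and [W p q] are expectations of [s ^+ m] and [u ^+ p * v ^+ q], with [s]
    independent of [(u, v)], this is the expectation of
    [s ^+ e * (x * s + u) ^+ k * (y * s + v) ^+ l]. *)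
Definition two_power_sum W e k l : A :=
  \sum_(p : 'I_k.+2 * 'I_l.+2) ('C(k, p.1) * 'C(l, p.2))%:R *
    (x ^+ p.1 * y ^+ p.2) * (G (e + p.1 + p.2) * W (k - p.1)%N (l - p.2)%N).

End SteinSums.

Section Stein.
Context {A : comNzRingType} (G : nat -> A).
Hypothesis GS : forall m, 2 * G m.+1 = m%:R * G m.-1.

(** The absorption identity [a * 'C(k, a) = k * 'C(k.-1, a.-1)], followed by a shift
    of the index [a]. *)
Let absorb (x y : A) W k l :
  \sum_(a < k.+2) \sum_(b < l.+2) ('C(k, a) * 'C(l, b))%:R *
    (x ^+ a * y ^+ b) * (a%:R * G (a + b).-1 * W (k - a)%N (l - b)%N) =
  k%:R * x * two_power_sum G x y W 0 k.-1 l.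
Proof.
rewrite big_ord_recl /= big1 ?add0r => [|b _]; last by rewrite !mul0r mulr0.
case: k => [|k].
  rewrite !mul0r big1// => a _; rewrite big1// => b _.
  by rewrite bin_small// mul0n !mul0r.
rewrite /two_power_sum -(pair_big xpredT xpredT (fun (a : 'I_k.+2) (b : 'I_l.+2) => ('C(k, a) * 'C(l, b))%:R *
    (x ^+ a * y ^+ b) * (G (0 + a + b) * W (k - a)%N (l - b)%N)))/=.
rewrite mulr_sumr; apply: eq_bigr => a _; rewrite mulr_sumr; apply: eq_bigr => b _.
rewrite /bump/= add1n subSS ?addSn add0n /= exprS.
have e : (a.+1%:R * 'C(k.+1, a.+1)%:R : A) = k.+1%:R * 'C(k, a)%:R.
  by rewrite -!natrM -mul_bin_diag.
rewrite !natrM.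
transitivity ((a.+1%:R * 'C(k.+1, a.+1)%:R) * ('C(l, b)%:R * x * x ^+ a * y ^+ b *
  G (a + b)%N * W (k - a)%N (l - b)%N)); first by ring.
by rewrite e; ring.
Qed.

(** Gaussian integration by parts in the variable with moments [G], of variance
    one half, applied to a product of two powers. *)
Lemma two_power_sum_stein (x y : A) W k l :
  2 * two_power_sum G x y W 1 k l =
  k%:R * x * two_power_sum G x y W 0 k.-1 l +
  l%:R * y * two_power_sum G x y W 0 k l.-1.
Proof.
have swap k' l' : two_power_sum G x y W 0 k' l' =
    two_power_sum G y x (fun q p => W p q) 0 l' k'.
  rewrite /two_power_sum.
  rewrite -(pair_big xpredT xpredT (fun (a : 'I_k'.+2) (b : 'I_l'.+2) => ('C(k', a) * 'C(l', b))%:R *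
    (x ^+ a * y ^+ b) * (G (0 + a + b) * W (k' - a)%N (l' - b)%N)))/=.
  rewrite exchange_big/= pair_big/=; apply: eq_bigr => p _.
  by rewrite mulnC -addnA [(p.2 + p.1)%N]addnC addnA; ring.
rewrite [X in _ = _ + _ * X]swap -!absorb [X in _ = _ + X]exchange_big/= -big_split/=.
rewrite /two_power_sum.
rewrite -(pair_big xpredT xpredT (fun (a : 'I_k.+2) (b : 'I_l.+2) => ('C(k, a) * 'C(l, b))%:R *
  (x ^+ a * y ^+ b) * (G (1 + a + b) * W (k - a)%N (l - b)%N)))/=.
rewrite mulr_sumr; apply: eq_bigr => a _.
rewrite mulr_sumr -big_split/=; apply: eq_bigr => b _.
rewrite -addnA add1n.
transitivity (('C(k, a) * 'C(l, b))%:R * (x ^+ a * y ^+ b) *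
  (2 * G (a + b).+1 * W (k - a)%N (l - b)%N)); first by ring.
by rewrite GS natrD [(b + a)%N]addnC !natrM; ring.
Qed.

End Stein.

Section ComplexGaussian.
Context {R : realType}.
Local Notation PP := (@gauss_pair R).
Local Notation I1 := ((0 : R) +i* 1)%C.
Local Notation I2 := ((0 : R) -i* 1)%C.

Let power (g : R * R) (k l : nat) : R[i] :=
  (g.1 +i* g.2)%C ^+ k * (((g.1 +i* g.2)%C)^*)%C ^+ l.

Let mom k l := complex_gaussian_moment k l : R[i].

Let h m : R[i] := (half_moment m : R)%:C%C.

Let hS m : 2 * h m.+1 = m%:R * h m.-1.
Proof.
have := congr1 (fun x : R => x%:C%C) (half_momentS (R := R) m).
by rewrite !rmorphM !rmorph_nat.
Qed.

Let hE m : cexpectation (@gauss_half R) (fun x => x%:C%C ^+ m) = h m.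
Proof.
under eq_fun do rewrite -rmorphXn /=.
rewrite cexpectationE /h /half_moment /cpart /=; congr (_ +i* _)%C.
by rewrite /Rintegral integral0.
Qed.

Let fX : finite_moments PP (fun g => (g.1)%:C%C).
Proof. exact: (finite_moments_fst _ gauss_half_finite_moments). Qed.

Let fY : finite_moments PP (fun g => (g.2)%:C%C).
Proof. exact: (finite_moments_snd _ gauss_half_finite_moments). Qed.

Let hhE a b : cexpectation PP (fun g => (g.1)%:C%C ^+ a * (g.2)%:C%C ^+ b) = h a * h b.
Proof.
rewrite -!hE; apply: (@cexpectation_fst_snd _ _ (measurableTypeR R) (measurableTypeR R)
  R gauss_half gauss_half (fun x => (x : R)%:C%C ^+ a) (fun y => (y : R)%:C%C ^+ b)).
  by apply: finite_momentsX; exact: gauss_half_finite_moments.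
by apply: finite_momentsX; exact: gauss_half_finite_moments.
Qed.

Let GE (g : R * R) : (g.1 +i* g.2)%C = (g.1)%:C%C + I1 * (g.2)%:C%C.
Proof. by apply/eqP; rewrite eq_complex /=; apply/andP; split; apply/eqP; ring. Qed.

Let GcE (g : R * R) : (((g.1 +i* g.2)%C)^*)%C = (g.1)%:C%C + I2 * (g.2)%:C%C.
Proof. by apply/eqP; rewrite eq_complex /=; apply/andP; split; apply/eqP; ring. Qed.

Let fG : finite_moments PP (fun g => (g.1 +i* g.2)%C).
Proof.
under eq_fun do rewrite GE; apply: finite_momentsD => //.
by apply: finite_momentsM => //; exact: finite_moments_cst.
Qed.

Let fpower k l : finite_moments PP (fun g => power g k l).
Proof.
apply: finite_momentsM; first exact: finite_momentsX.
by apply: finite_momentsX; exact: finite_moments_conj.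
Qed.

Let W (p q : nat) : R[i] := (I1 ^+ p * I2 ^+ q) * h (p + q).

Let momX e k l : cexpectation PP (fun g => (g.1)%:C%C ^+ e * power g k l) =
  two_power_sum h 1 1 W e k l.
Proof.
pose t (p : 'I_k.+2 * 'I_l.+2) (g : R * R) : R[i] :=
  (('C(k, p.1) * 'C(l, p.2))%:R * (I1 ^+ (k - p.1) * I2 ^+ (l - p.2))) *
  ((g.1)%:C%C ^+ (e + p.1 + p.2) * (g.2)%:C%C ^+ (k - p.1 + (l - p.2))).
have ft (p : 'I_k.+2 * 'I_l.+2) : finite_moments PP (fun g => (g.1)%:C%C ^+ (e + p.1 + p.2) *
    (g.2)%:C%C ^+ (k - p.1 + (l - p.2))).
  by apply: finite_momentsM; exact: finite_momentsX.
rewrite (_ : (fun g => _) = fun g => \sum_p t p g); last first.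
  apply/funext => g; rewrite /power GcE GE expand_two_powers mulr_sumr.
  by apply: eq_bigr => p _; rewrite /t !exprMn !exprD; ring.
rewrite cexpectation_sum => [|p]; rewrite /t; last first.
  by apply: finite_momentsM => //; exact: finite_moments_cst.
apply: eq_bigr => p _; rewrite /t cexpectationZ//.
by rewrite hhE /W !expr1n; ring.
Qed.

Let momY e k l : cexpectation PP (fun g => (g.2)%:C%C ^+ e * power g k l) =
  two_power_sum h I1 I2 (fun p q => h (p + q)) e k l.
Proof.
pose t (p : 'I_k.+2 * 'I_l.+2) (g : R * R) : R[i] :=
  (('C(k, p.1) * 'C(l, p.2))%:R * (I1 ^+ p.1 * I2 ^+ p.2)) *
  ((g.1)%:C%C ^+ (k - p.1 + (l - p.2)) * (g.2)%:C%C ^+ (e + p.1 + p.2)).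
have ft (p : 'I_k.+2 * 'I_l.+2) : finite_moments PP (fun g => (g.1)%:C%C ^+ (k - p.1 + (l - p.2)) *
    (g.2)%:C%C ^+ (e + p.1 + p.2)).
  by apply: finite_momentsM; exact: finite_momentsX.
rewrite (_ : (fun g => _) = fun g => \sum_p t p g); last first.
  apply/funext => g; rewrite /power GcE GE ![(g.1)%:C%C + _]addrC.
  rewrite expand_two_powers mulr_sumr.
  by apply: eq_bigr => p _; rewrite /t !exprMn !exprD; ring.
rewrite cexpectation_sum => [|p]; rewrite /t; last first.
  by apply: finite_momentsM => //; exact: finite_moments_cst.
apply: eq_bigr => p _; rewrite /t cexpectationZ//.
by rewrite hhE; ring.
Qed.

Let mom0X k l : two_power_sum h 1 1 W 0 k l = mom k l.
Proof.
by rewrite -momX; congr (cexpectation PP _); apply/funext => g; rewrite mul1r.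
Qed.

Let mom0Y k l : two_power_sum h I1 I2 (fun p q => h (p + q)) 0 k l = mom k l.
Proof.
by rewrite -momY; congr (cexpectation PP _); apply/funext => g; rewrite mul1r.
Qed.

Let steinX k l : 2 * cexpectation PP (fun g => (g.1)%:C%C * power g k l) =
  k%:R * mom k.-1 l + l%:R * mom k l.-1.
Proof.
by rewrite (momX 1) two_power_sum_stein// !mom0X !mulr1.
Qed.

Let steinY k l : 2 * cexpectation PP (fun g => (g.2)%:C%C * power g k l) =
  k%:R * I1 * mom k.-1 l + l%:R * I2 * mom k l.-1.
Proof. by rewrite (momY 1) two_power_sum_stein// !mom0Y. Qed.

Let I11 : I1 * I1 = -1 :> R[i].
Proof. by apply/eqP; rewrite eq_complex /=; apply/andP; split; apply/eqP; ring. Qed.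
Let I12 : I1 * I2 = 1 :> R[i].
Proof. by apply/eqP; rewrite eq_complex /=; apply/andP; split; apply/eqP; ring. Qed.
Let I22 : I2 * I2 = -1 :> R[i].
Proof. by apply/eqP; rewrite eq_complex /=; apply/andP; split; apply/eqP; ring. Qed.

Let mom_lin (c : R[i]) k l :
  cexpectation PP (fun g => ((g.1)%:C%C + c * (g.2)%:C%C) * power g k l) =
  2^-1 * ((k%:R * mom k.-1 l + l%:R * mom k l.-1) +
    c * (k%:R * I1 * mom k.-1 l + l%:R * I2 * mom k l.-1)).
Proof.
under eq_fun do rewrite mulrDl -mulrA.
have fXp : finite_moments PP (fun g => (g.1)%:C%C * power g k l) by exact: finite_momentsM.
have fYp : finite_moments PP (fun g => (g.2)%:C%C * power g k l) by exact: finite_momentsM.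
rewrite cexpectationD//; last first.
  by apply: finite_momentsM => //; exact: finite_moments_cst.
by rewrite cexpectationZ// -steinX -steinY; field.
Qed.

(** Here [I1 * I1 = -1] cancels the derivatives of the unstarred factors in the
    two directions, while [I1 * I2 = 1] adds up those of the starred ones. *)
Let momSl k l : mom k.+1 l = l%:R * mom k l.-1.
Proof.
transitivity (cexpectation PP (fun g => ((g.1)%:C%C + I1 * (g.2)%:C%C) * power g k l)).
  congr (cexpectation PP _); apply/funext => g.
  by rewrite -GE /power exprS mulrA.
rewrite mom_lin mulrDr.
transitivity (2^-1 * ((1 + I1 * I1) * (k%:R * mom k.-1 l) +
  (1 + I1 * I2) * (l%:R * mom k l.-1))); first by ring.
by rewrite I11 I12; field.
Qed.

Let momSr k l : mom k l.+1 = k%:R * mom k.-1 l.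
Proof.
transitivity (cexpectation PP (fun g => ((g.1)%:C%C + I2 * (g.2)%:C%C) * power g k l)).
  congr (cexpectation PP _); apply/funext => g.
  by rewrite -GcE /power exprS mulrCA.
rewrite mom_lin mulrDr.
transitivity (2^-1 * ((1 + I1 * I2) * (k%:R * mom k.-1 l) +
  (1 + I2 * I2) * (l%:R * mom k l.-1))); first by ring.
by rewrite I22 I12; field.
Qed.

Lemma complex_gaussian_momentE k l :
  complex_gaussian_moment k l = ((k == l) * k`!)%:R :> R[i].
Proof.
elim: k l => [|k IH] [|l].
- rewrite /complex_gaussian_moment.
  under eq_fun do rewrite /= !expr0 mulr1; exact: cexpectation_cst.
- by rewrite -/(mom _ _) momSr mul0r mul0n.
- by rewrite -/(mom _ _) momSl mul0r mul0n.
rewrite -/(mom _ _) momSl /mom IH /= eqSS -natrM.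
have [->|_] := eqVneq k l; first by rewrite !mul1n factS.
by rewrite !mul0n muln0.
Qed.

End ComplexGaussian.

(** * Independent complex Gaussian variables *)

(** One Gaussian pair is adjoined at a time, as a further factor of a product
    space. *)
Lemma gaussian_family (R : realType) (k : nat) :
  exists (d : measure_display) (T : measurableType d) (P : probability T R)
         (g : 'I_k -> T -> R[i]),
    (forall j, finite_moments P (g j)) /\
    forall K L : 'I_k -> nat,
      cexpectation P (fun w => \prod_(j < k) (g j w ^+ K j * ((g j w)^*)%C ^+ L j)) =
      \prod_(j < k) complex_gaussian_moment (K j) (L j).
Proof.
elim: k => [|k [d [T [P [g [fg gE]]]]]].
  exists _, _, (@gauss_half R), (fun _ _ => 0); split=> [|K L].
    by case.
  by under eq_fun do rewrite big_ord0; rewrite cexpectation_cst big_ord0.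
pose G (x : R * R) : R[i] := (x.1 +i* x.2)%C.
have fG : finite_moments (@gauss_pair R) G.
  rewrite (_ : G = fun x => (x.1)%:C%C + ((0 : R) +i* 1)%C * (x.2)%:C%C).
    apply: finite_momentsD.
      exact: (finite_moments_fst _ gauss_half_finite_moments).
    apply: finite_momentsM; first exact: finite_moments_cst.
    exact: (finite_moments_snd _ gauss_half_finite_moments).
  apply/funext => x; apply/eqP; rewrite eq_complex /=.
  by apply/andP; split; apply/eqP; ring.
pose g' (j : 'I_k.+1) (w : T * (measurableTypeR R * measurableTypeR R)) : R[i] :=
  if unlift ord0 j is Some i then g i w.1 else G w.2.
exists _, _, ((P \x @gauss_pair R)%E : probability _ R), g'; split=> [j|K L].
  rewrite /g'; case: (unlift ord0 j) => [i|].
    exact: (finite_moments_fst _ (fg i)).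
  exact: (finite_moments_snd _ fG).
rewrite big_ord_recl.
have -> : (fun w => \prod_(j < k.+1) (g' j w ^+ K j * ((g' j w)^*)%C ^+ L j)) =
    fun w => (\prod_(j < k) (g j w.1 ^+ K (lift ord0 j) *
                             ((g j w.1)^*)%C ^+ L (lift ord0 j))) *
             (G w.2 ^+ K ord0 * ((G w.2)^*)%C ^+ L ord0).
  apply/funext => w; rewrite big_ord_recl mulrC /g' unlift_none; congr (_ * _).
  by apply: eq_bigr => j _; rewrite liftK.
rewrite (@cexpectation_fst_snd _ _ _ _ _ P (@gauss_pair R)
  (fun w => \prod_(j < k) (g j w ^+ K (lift ord0 j) * ((g j w)^*)%C ^+ L (lift ord0 j)))
  (fun x => G x ^+ K ord0 * ((G x)^*)%C ^+ L ord0)).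
- by rewrite mulrC gE.
- apply: finite_moments_prod => j; apply: finite_momentsM; apply: finite_momentsX => //.
  exact: finite_moments_conj.
- apply: finite_momentsM; apply: finite_momentsX => //.
  exact: finite_moments_conj.
Qed.

Section Evaluation.
Context d (T : measurableType d) (R : realType) (P : probability T R) (n : nat).
Implicit Types X Y : rmatrix P n.

Lemma rmatrix_funM X Y w : rmatrix_fun (X * Y) w = rmatrix_fun X w *m rmatrix_fun Y w.
Proof. by []. Qed.

Lemma rmatrix_fun_prod (I : Type) (r : seq I) (X_ : I -> rmatrix P n) w :
  rmatrix_fun (\prod_(i <- r) X_ i) w = \prod_(i <- r) rmatrix_fun (X_ i) w.
Proof.
elim: r => [|i r IH]; first by rewrite !big_nil.
by rewrite !big_cons rmatrix_funM IH.
Qed.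

Lemma rmatrix_fun_star X w :
  rmatrix_fun (star X) w = map_mx conjc (rmatrix_fun X w)^T.
Proof. by []. Qed.

Lemma rmatrix_funZ c X w : rmatrix_fun (c *: X) w = c *: rmatrix_fun X w.
Proof. by []. Qed.

Lemma rmatrix_fun_inj X Y : (forall w, rmatrix_fun X w = rmatrix_fun Y w) -> X = Y.
Proof. by move=> XY; apply: val_inj; apply/funext => w; exact: XY. Qed.

End Evaluation.

Lemma prod_count (A : comNzRingType) (I : finType) (f : I -> A) (w : seq I) :
  \prod_(l <- w) f l = \prod_i f i ^+ count_mem i w.
Proof.
elim: w => [|x w IH]; first by rewrite big_nil big1// => i _; rewrite expr0.
rewrite big_cons IH [in RHS](eq_bigr (fun i => f i ^+ (x == i) * f i ^+ count_mem i w)).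
  rewrite big_split/=; congr (_ * _).
  rewrite (bigD1 x)//= eqxx big1 ?mulr1// => i ix.
  by rewrite eq_sym (negbTE ix).
by move=> i _; rewrite -exprD.
Qed.

Lemma prod_star_word (A : comNzRingType) k (u v : 'I_k -> A) (w : seq ('I_k * bool)) :
  \prod_(l <- w) (if l.2 then v l.1 else u l.1) =
  \prod_(j < k) (u j ^+ count_mem (j, false) w * v j ^+ count_mem (j, true) w).
Proof.
rewrite prod_count -(pair_big xpredT xpredT
  (fun (j : 'I_k) (b : bool) => (if b then v j else u j) ^+ count_mem (j, b) w))/=.
  by apply: eq_bigr => j _; rewrite big_bool mulrC.
Qed.

Section ScalarModel.
Context d (T : measurableType d) (R : realType) (P : probability T R) (k : nat).
Variable g : 'I_k -> T -> R[i].
Hypothesis fg : forall j, finite_moments P (g j).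

Let scalar_mx_moments j : finite_moments_mx P (fun w => (g j w)%:M : 'M[R[i]]_1).
Proof.
apply/asboolP => a b; rewrite (_ : (fun w => _) = g j); first exact: fg.
by apply/funext => w; rewrite !ord1 mxE mulr1n.
Qed.

(** Matrices of size one turn complex random variables into elements of a
    noncommutative probability space. *)
Definition scalar_rmatrix j : rmatrix P 0 := Sub _ (scalar_mx_moments j).

Let M11 (M : 'M[R[i]]_1) : M = (M 0 0)%:M.
Proof. by apply/matrixP => a b; rewrite !ord1 mxE mulr1n. Qed.

Lemma rmatrix1_comm (X Y : rmatrix P 0) : X * Y = Y * X.
Proof.
apply: rmatrix_fun_inj => w; rewrite !rmatrix_funM.
by rewrite (M11 (rmatrix_fun X w)) (M11 (rmatrix_fun Y w)) -!scalar_mxM mulrC.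
Qed.

Lemma scalar_rmatrix_fun_star j w :
  rmatrix_fun (star (scalar_rmatrix j)) w = (((g j w)^*)%C)%:M.
Proof.
rewrite rmatrix_fun_star; apply/matrixP => a b.
by rewrite !ord1 !mxE /= mulr1n mulr1n.
Qed.

Lemma scalar_mxX (c : R[i]) e : (c%:M : 'M[R[i]]_1) ^+ e = (c ^+ e)%:M.
Proof. by rewrite -[RHS]/(scalar_mx _) rmorphXn. Qed.

Lemma rmatrix_funX (X : rmatrix P 0) e w : rmatrix_fun (X ^+ e) w = rmatrix_fun X w ^+ e.
Proof. by elim: e => [|e IH]; rewrite ?expr0// !exprS rmatrix_funM IH. Qed.

Lemma scalar_mx_prod (I : Type) (r : seq I) (c : I -> R[i]) :
  \prod_(i <- r) ((c i)%:M : 'M[R[i]]_1) = (\prod_(i <- r) c i)%:M.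
Proof. by rewrite -[RHS]/(scalar_mx _) rmorph_prod. Qed.

Lemma scalar_rmatrix_power j K L w :
  rmatrix_fun (scalar_rmatrix j ^+ K * star (scalar_rmatrix j) ^+ L) w =
  (g j w ^+ K * ((g j w)^*)%C ^+ L)%:M.
Proof.
by rewrite rmatrix_funM !rmatrix_funX scalar_rmatrix_fun_star !scalar_mxX -scalar_mxM.
Qed.

Lemma rmatrix1_state (X : rmatrix P 0) (Z : T -> R[i]) :
  (forall w, rmatrix_fun X w = (Z w)%:M) -> rmatrix_state X = cexpectation P Z.
Proof.
move=> XZ; rewrite /rmatrix_state invr1 mul1r; congr (cexpectation P _).
by apply/funext => w; rewrite XZ mxtrace_scalar.
Qed.

End ScalarModel.

(** The state of a word is left in terms of the moments of its letters, ready to be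
    compared with the limit of the matrix model. *)
Lemma gaussian_model (R : realType) (k : nat) :
  exists (A : ncp R) (a : 'I_k -> A),
    [/\ forall j, standard_complex_gaussian (a j), ncp_independent a &
      forall Q : star_monomial R k, ncp_state A (eval_monomial a Q) =
        Q.1 * \prod_(j < k) complex_gaussian_moment
                (count_mem (j, false) Q.2) (count_mem (j, true) Q.2)].
Proof.
have [d [T [P [g [fg gE]]]]] := gaussian_family R k.
have one j (K L : nat) : cexpectation P (fun w => g j w ^+ K * ((g j w)^*)%C ^+ L) =
    complex_gaussian_moment K L.
  have := gE (fun i => if i == j then K else 0%N) (fun i => if i == j then L else 0%N).
  rewrite (bigD1 j)//= eqxx [X in _ = _ * X]big1 ?mulr1 => [<-|i ij].
    congr (cexpectation P _); apply/funext => w; rewrite (bigD1 j)//= eqxx.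
    by rewrite big1 ?mulr1// => i ij; rewrite (negbTE ij) !expr0 mulr1.
  by rewrite (negbTE ij) complex_gaussian_momentE.
exists (rmatrix_ncp P 0), (scalar_rmatrix fg); split.
- move=> j; split; first exact: rmatrix1_comm.
  move=> K L /=; rewrite -(one j).
  by apply: rmatrix1_state => w; exact: scalar_rmatrix_power.
- split; first by move=> i j; exact: rmatrix1_comm.
  move=> K L /=.
  under [RHS]eq_bigr => j _.
    rewrite (rmatrix1_state (Z := fun w => g j w ^+ K j * ((g j w)^*)%C ^+ L j)).
      rewrite one; over.
    by move=> w; exact: scalar_rmatrix_power.
  rewrite -gE; apply: rmatrix1_state => w.
  rewrite rmatrix_fun_prod -scalar_mx_prod; apply: eq_bigr => j _.
  exact: scalar_rmatrix_power.
move=> [c w]; rewrite /eval_monomial linearZ /=; congr (_ * _).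
rewrite -gE; apply: rmatrix1_state => t.
rewrite rmatrix_fun_prod -(prod_star_word (g^~ t) (fun j => ((g j t)^*)%C)).
rewrite -scalar_mx_prod; apply: eq_bigr => -[j b] _; rewrite /eval_letter/=.
by case: b => //; exact: scalar_rmatrix_fun_star.
Qed.

(** * Inputs of random skew-circulant matrices *)

Section Rate.
Context {R : realType}.

Definition inv_sqrt (n : nat) : R[i] := (((Num.sqrt n.+1%:R)^-1 : R)%:C)%C.

Lemma inv_sqrt_ge0 n : 0 <= inv_sqrt n.
Proof. by rewrite lecR invr_ge0 sqrtr_ge0. Qed.

Lemma inv_sqrt_le1 n : inv_sqrt n <= 1.
Proof.
rewrite lecR invf_le1 ?sqrtr_gt0// -[leLHS]sqrtr1 ler_wsqrtr//.
by rewrite ler1n.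
Qed.

Lemma inv_sqrt_sqr n : n.+1%:R * inv_sqrt n ^+ 2 = 1.
Proof.
rewrite /inv_sqrt -rmorphXn exprVn sqr_sqrtr// -(rmorph_nat (real_complex R)).
by rewrite -rmorphM mulfV ?rmorph1// pnatr_eq0.
Qed.

Lemma cvg_inv_sqrt_rate (x : nat -> R[i]) (L K : R[i]) :
  (forall n, `|x n - L| <= K * inv_sqrt n) ->
  (x : nat -> R[i]^o) @ \oo --> (L : R[i]^o).
Proof.
move=> xL; apply/cvgrPdist_lt => e e0.
have K0 : 0 <= K.
  have h0 : 0 < inv_sqrt 0 by rewrite ltcR invr_gt0 sqrtr_gt0.
  by rewrite -(pmulr_lge0 _ h0) (le_trans _ (xL 0%N)).
have eE : e = ((complex.Re e)%:C)%C.
  by move: e0; case: (e) => a b; rewrite ltcE/= => /andP[/eqP -> _].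
have KE : K = ((complex.Re K)%:C)%C.
  by move: K0; case: (K) => a b; rewrite lecE/= => /andP[/eqP -> _].
move: e0 K0 xL; rewrite eE KE; move: (complex.Re e) (complex.Re K) => {eE KE}e' k.
rewrite ltcR lecR => e0 k0 xL.
(* [k / sqrt n.+1 < e'] as soon as [(k / e') ^+ 2 < n.+1] *)
exists (Num.truncn ((k / e') ^+ 2)).+1 => // n /= hn.
rewrite distrC (le_lt_trans (xL n))// /inv_sqrt -rmorphM ltcR.
rewrite ltr_pdivrMr ?sqrtr_gt0// mulrC -ltr_pdivrMr//.
have -> : k / e' = Num.sqrt ((k / e') ^+ 2).
  by rewrite sqrtr_sqr ger0_norm// divr_ge0// ltW.
rewrite ltr_sqrt ?ltr0n// (lt_le_trans (truncnS_gt _))// ler_nat.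
by rewrite ltnS ltnW.
Qed.

End Rate.

Section Inputs.
Context d (T : measurableType d) (R : realType) (P : probability T R).
Variable s : nat -> {RV P >-> R}.
Hypothesis mean0 : forall i, ('E_P[s i] = 0)%E.
Hypothesis var1 : forall i, ('V_P[s i] = 1)%E.
Hypothesis bnd : bounded_moments s.

Lemma input_moments i : finite_moments P (fun w => (s i w)%:C%C).
Proof.
apply: finite_moments_real => [|m]; first exact: measurable_funP.
by have [C /(_ i) sC] := bnd m; exact: le_lt_trans sC (ltry C).
Qed.

Lemma input_momentE i e : moment s i e = ((\int[P]_w (s i w ^+ e))%:C)%C.
Proof.
rewrite /moment; under eq_fun do rewrite -rmorphXn /=.
rewrite cexpectationE /cpart /=; congr (_ +i* _)%C.
by rewrite /Rintegral integral0.
Qed.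

Lemma input_moment1 i : moment s i 1 = 0.
Proof.
rewrite input_momentE; under eq_Rintegral do rewrite expr1.
by have := mean0 i; rewrite unlock /Rintegral => ->.
Qed.

Lemma input_moment2 i : moment s i 2 = 1.
Proof.
rewrite input_momentE; have := var1 i; rewrite /variance.
rewrite covariance.unlock mean0 /= expectation.unlock => e.
rewrite /Rintegral (_ : (\int[P]_x _)%E = 1%E)// -[RHS]e.
apply: eq_integral => w _; congr EFin; rewrite expr2.
by rewrite -[s i w in LHS]subr0.
Qed.

Lemma input_moment_bound : exists M : nat -> R[i], forall i e, `|moment s i e| <= M e.
Proof.
have /choice[C HC] := bnd; exists (fun e => ((C e)%:C)%C) => i e.
rewrite input_momentE normc_def /= expr0n /= addr0 sqrtr_sqr lecR.
have fi : P.-integrable [set: T] (EFin \o (fun w => s i w ^+ e)).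
  have := finite_moments_Re (finite_momentsX e (input_moments i)).
  by under eq_fun do rewrite -rmorphXn /=.
apply: (le_trans (le_normr_Rintegral _ fi)) => //.
have := HC e i; rewrite expectation.unlock -[X in (X <= _)%E]fineK; last first.
  apply: integrable_fin_num => //.
  have := integrable_abse fi; congr (P.-integrable _ _).
  by apply/funext => w /=; rewrite normrX.
rewrite lee_fin; apply: le_trans; rewrite le_eqVlt; apply/orP; left; apply/eqP.
by apply: eq_Rintegral => w _; rewrite normrX.
Qed.

End Inputs.

Section Adapted.

Definition cmeasurable d (T : measurableType d) (R : realType) (Z : T -> R[i]) :=
  forall b, measurable_fun [set: T] (fun w => cpart b (Z w)).

Context d (T : measurableType d) (R : realType).
Implicit Types Z W : T -> R[i].

Lemma cmeasurable_cst c : @cmeasurable d T R (fun=> c).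
Proof. by move=> b; exact: measurable_cst. Qed.

Lemma cmeasurable_real (X : T -> R) : measurable_fun [set: T] X ->
  cmeasurable (fun w => (X w)%:C%C).
Proof. by move=> mX [|] //=; exact: measurable_cst. Qed.

Lemma cmeasurableD Z W : cmeasurable Z -> cmeasurable W ->
  cmeasurable (fun w => Z w + W w).
Proof.
move=> mZ mW b; rewrite (_ : (fun w => _) =
    (fun w => cpart b (Z w)) \+ (fun w => cpart b (W w))).
  exact: measurable_funD.
by apply/funext => w; case: b => /=; case: (Z w) (W w) => ? ? [].
Qed.

Lemma cmeasurableM Z W : cmeasurable Z -> cmeasurable W ->
  cmeasurable (fun w => Z w * W w).
Proof.
move=> mZ mW [].
  rewrite (_ : (fun w => _) =
      ((fun w => cpart false (Z w)) \* (fun w => cpart true (W w))) \+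
      ((fun w => cpart true (Z w)) \* (fun w => cpart false (W w)))).
    by apply: measurable_funD; exact: measurable_funM.
  by apply/funext => w /=; case: (Z w) (W w) => ? ? [].
rewrite (_ : (fun w => _) =
    ((fun w => cpart false (Z w)) \* (fun w => cpart false (W w))) \-
    ((fun w => cpart true (Z w)) \* (fun w => cpart true (W w)))).
  by apply: measurable_funB; exact: measurable_funM.
by apply/funext => w /=; case: (Z w) (W w) => ? ? [].
Qed.

Lemma cmeasurable_conj Z : cmeasurable Z -> cmeasurable (fun w => ((Z w)^*)%C).
Proof.
move=> mZ [].
  rewrite (_ : (fun w => _) = (fun w => - cpart true (Z w))).
    by apply: measurableT_comp => //; exact: mZ.
  by apply/funext => w; case: (Z w).
rewrite (_ : (fun w => _) = (fun w => cpart false (Z w)))//.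
by apply/funext => w; case: (Z w).
Qed.

Lemma cmeasurableX Z e : cmeasurable Z -> cmeasurable (fun w => Z w ^+ e).
Proof.
move=> mZ; elim: e => [|e IH].
  by under eq_fun do rewrite expr0; exact: cmeasurable_cst.
by under eq_fun do rewrite exprS; exact: cmeasurableM.
Qed.

Lemma cmeasurable_sum (I : eqType) (r : seq I) (Z_ : I -> T -> R[i]) :
  (forall i, i \in r -> cmeasurable (Z_ i)) ->
  cmeasurable (fun w => \sum_(i <- r) Z_ i w).
Proof.
elim: r => [_|i r IH h].
  by under eq_fun do rewrite big_nil; exact: cmeasurable_cst.
under eq_fun do rewrite big_cons; apply: cmeasurableD; first exact/h/mem_head.
by apply: IH => j jr; apply: h; rewrite inE jr orbT.
Qed.

End Adapted.

Section MatrixSystem.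
Context d (T : measurableType d) (R : realType) (P : probability T R).
Variables (s : nat -> {RV P >-> R}) (n : nat).
Let X : T -> 'M[R]_n.+1 := random_skew_circulant n.+1 s.
Let G : set_system T := [set E | exists i j, sigma_of_rv (fun w => X w i j) E].

Lemma measurable_skew_entry i j : measurable_fun [set: T] (fun w => X w i j).
Proof.
rewrite (_ : (fun w => X w i j) = fun w =>
    if (i <= j)%N then s (j - i)%N w else - s (n.+1 + j - i)%N w).
  by case: (i <= j)%N; [exact: measurable_funP|apply: measurableT_comp].
by apply/funext => w; rewrite mxE.
Qed.

Lemma sigma_of_rmx_measurable E : sigma_of_rmx X E -> measurable E.
Proof.
apply: smallest_sub; first exact: sigma_algebra_measurable.
move=> _ [i [j [B mB <-]]]; rewrite setTI -[_ @^-1` _]setTI.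
exact: measurable_skew_entry.
Qed.

(** The first row of a skew-circulant matrix lists its input. *)
Let measurable_input m : (m < n.+1)%N ->
  measurable_fun [set: g_sigma_algebraType G] (s m : g_sigma_algebraType G -> R).
Proof.
move=> mn _ B mB; apply: sub_sigma_algebra.
exists ord0, (Ordinal mn), B => //.
rewrite (_ : (fun w => X w ord0 (Ordinal mn)) = s m)//.
by apply/funext => w; rewrite mxE /= subn0.
Qed.

Lemma adapted_star_power c k l :
  adapted (sigma_of_rmx X) (star_power s c (iota 0 n.+1) k l).
Proof.
have mZ : @cmeasurable _ (g_sigma_algebraType G) R (weighted_sum s c (iota 0 n.+1)).
  apply: cmeasurable_sum => m; rewrite mem_iota add0n => /= mn.
  apply: cmeasurableM; first exact: cmeasurable_cst.
  by apply: cmeasurable_real; exact: measurable_input.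
have mp : @cmeasurable _ (g_sigma_algebraType G) R (star_power s c (iota 0 n.+1) k l).
  apply: cmeasurableM; first exact: cmeasurableX.
  by apply: cmeasurableX; exact: cmeasurable_conj.
by move=> b B mB; have := mp b measurableT B mB; rewrite setTI.
Qed.

End MatrixSystem.

(** Telescoping: replacing the factors one at a time, with the current partial
    product bounded by the limiting one plus its error. *)
Lemma prod_close (F : numDomainType) (I : Type) (r : seq I) (a D : I -> F) :
  (forall i, 0 <= D i) ->
  exists2 D' : F, 0 <= D' & forall (h : F) (x : I -> F), 0 <= h <= 1 ->
    (forall i, `|x i - a i| <= D i * h) ->
    `|\prod_(i <- r) x i - \prod_(i <- r) a i| <= D' * h.
Proof.
move=> D0; elim: r => [|i r [D' D'0 IH]].
  by exists 0 => // h x _ _; rewrite !big_nil subrr normr0 mul0r.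
pose A := \prod_(i <- r) a i.
exists (D i * (D' + `|A|) + `|a i| * D').
  by rewrite addr_ge0// mulr_ge0// addr_ge0.
move=> h x h01 xa; rewrite !big_cons -/A.
have {}IH := IH h x h01 xa; have /andP[h0 h1] := h01.
rewrite (_ : _ - _ = (x i - a i) * \prod_(i <- r) x i +
  a i * (\prod_(i <- r) x i - A)); last by ring.
rewrite (le_trans (ler_normD _ _))// [leRHS]mulrDl !normrM lerD//; last first.
  by rewrite -mulrA ler_wpM2l.
rewrite [leRHS]mulrAC ler_pM//.
rewrite -[\prod_(i <- r) x i](subrK A) (le_trans (ler_normD _ _))// lerD//.
by rewrite (le_trans IH)// ler_piMr.
Qed.

(** * Convergence *)

Section SkewMoments.
Context d (T : measurableType d) (R : realType) (P : probability T R).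
Variable s : nat -> {RV P >-> R}.
Hypothesis mean0 : forall i, ('E_P[s i] = 0)%E.
Hypothesis var1 : forall i, ('V_P[s i] = 1)%E.
Hypothesis bnd : bounded_moments s.
Hypothesis indep : independent_rvs P (fun i w => s i w).

Definition skew_weights n (z : R[i]) (m : nat) : R[i] := inv_sqrt n * z ^+ m.

(** The squared weights form a geometric progression of ratio [z ^+ 2] and length
    [n.+1]. As [(z ^+ 2) ^+ n.+1 = 1], their sum vanishes unless [z ^+ 2 = 1], and
    [z = 1] is not a root. At [z = -1] only the uniform bound on the moments is
    available. *)
Lemma skew_moment_rate k l : exists D : R[i], 0 <= D /\
  forall n (z : R[i]), z ^+ n.+1 = -1 -> `|z| = 1 ->
    `|star_moment s (skew_weights n z) (iota 0 n.+1) k l - ((k == l) * k`!)%:R| <=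
    D * (if z == -1 then 1 else inv_sqrt n).
Proof.
have fs := input_moments bnd; have [M sM] := input_moment_bound bnd.
have m1 := input_moment1 mean0; have m2 := input_moment2 mean0 var1.
have [K [K0 HK]] := star_moment_bounded fs indep m1 sM.
have [D D0 HD] := star_moment_limit fs indep m1 m2 sM k l.
exists (D + (K k l + ((k == l) * k`!)%:R)).
split=> [|n z zn z1]; first by rewrite addr_ge0// addr_ge0.
have h01 : 0 <= (inv_sqrt n : R[i]) <= 1 by rewrite inv_sqrt_ge0 inv_sqrt_le1.
have cz m : `|skew_weights n z m| = inv_sqrt n.
  by rewrite normrM normrX z1 expr1n mulr1 ger0_norm// inv_sqrt_ge0.
have sz : (size (iota 0 n.+1))%:R * inv_sqrt n ^+ 2 = 1 :> R[i].
  by rewrite size_iota inv_sqrt_sqr.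
case: ifPn => [_|zN1].
  rewrite mulr1 (le_trans (ler_normB _ _))// normr_nat -[leLHS]add0r lerD//.
  rewrite lerD2r; apply: (HK (inv_sqrt n)) => //; first by move=> i _; rewrite cz.
    exact: iota_uniq.
  by rewrite sz.
apply: (@le_trans _ _ (D * inv_sqrt n)); last first.
  by rewrite ler_wpM2r ?inv_sqrt_ge0// lerDl addr_ge0.
apply: HD => //; first exact: iota_uniq.
have z2 : z ^+ 2 != 1.
  rewrite sqrf_eq1 (negbTE zN1) orbF; apply: contra_eqN zn => /eqP ->.
  by rewrite expr1n -addr_eq0 -(natrD _ 1 1) pnatr_eq0.
rewrite -[iota _ _]/(index_iota 0 n.+1) big_mkord.
under eq_bigr do rewrite exprMn -exprM mulnC exprM.
rewrite -mulr_sumr; apply/eqP; rewrite mulf_eq0; apply/orP; right.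
have := subrX1 (z ^+ 2) n.+1.
rewrite -exprM mulnC exprM zn sqrrN expr1n subrr => /esym/eqP.
by rewrite mulf_eq0 subr_eq0 (negbTE z2).
Qed.

End SkewMoments.

Theorem theorem3p2 (R : realType) (d : measure_display) (T : measurableType d)
    (P : probability T R) (k : nat) (s : 'I_k -> nat -> {RV P >-> R})
    (mean0 : forall j i, ('E_P[s j i] = 0)%E)
    (var1 : forall j i, ('V_P[s j i] = 1)%E)
    (bnd : forall j, bounded_moments (s j))
    (indep_input : forall j, independent_rvs P (fun i w => s j i w))
    (indep_mx : forall n, independent_rmxs P
       (fun j w => random_skew_circulant n (s j) w)) :
  exists (A : ncp R) (a : 'I_k -> A),
    [/\ forall j, standard_complex_gaussian (a j),
        ncp_independent a &
        @cvg_star_distribution R k (rmatrix_ncp P)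
          (fun n j => ((Num.sqrt n.+1%:R)^-1 : R)%:C%C *:
             skew_circulant_rmatrix n (bnd j)) A a].
Proof.
have [A [a [sa ia aE]]] := gaussian_model R k.
exists A, a; split=> // -[c w]; rewrite aE /=.
pose K j := count_mem (j, false) w; pose L j := count_mem (j, true) w.
pose target (j : 'I_k) : R[i] := ((K j == L j) * (K j)`!)%:R.
rewrite (eq_bigr target) => [|j _]; last exact: complex_gaussian_momentE.
have /choice[D HD] := fun j => skew_moment_rate (mean0 j) (var1 j) (bnd j)
  (indep_input j) (K j) (L j).
have [D' D'0 HD'] := prod_close (index_enum 'I_k) target (fun j => (HD j).1).
apply: (cvg_inv_sqrt_rate (K := `|c| * (D' * 2))) => n.
have [z [z_inj z_root z_norm]] := @skew_roots R n.
pose x t j := star_moment (s j) (skew_weights n (z t)) (iota 0 n.+1) (K j) (L j).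
have stateE : rmatrix_state (eval_monomial (fun j => inv_sqrt n *:
    skew_circulant_rmatrix n (bnd j)) (c, w) : rmatrix P n) =
    c * (n.+1%:R^-1 * \sum_(t < n.+1) \prod_(j < k) x t j).
  rewrite /eval_monomial linearZ /=; congr (_ * (_ * _)).
  pose pw t om := \prod_(j < k)
    star_power (s j) (skew_weights n (z t)) (iota 0 n.+1) (K j) (L j) om.
  have trE om : \tr (rmatrix_fun (\prod_(l <- w) eval_letter (fun j => inv_sqrt n *:
      skew_circulant_rmatrix n (bnd j)) l : rmatrix P n) om) = \sum_(t < n.+1) pw t om.
    pose y j m : R[i] := inv_sqrt n * ((s j m om)%:C)%C.
    have eigE t j : skew_eigenvalue z (y j) t =
        weighted_sum (s j) (skew_weights n (z t)) (iota 0 n.+1) om.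
      rewrite /weighted_sum -[iota _ _]/(index_iota 0 n.+1) big_mkord.
      by apply: eq_bigr => m _; rewrite /y /skew_weights mulrCA mulrA.
    have matE j : rmatrix_fun (inv_sqrt n *: skew_circulant_rmatrix n (bnd j)) om =
        skew_circulant n.+1 (y j).
      apply/matrixP => p q; rewrite rmatrix_funZ !mxE /y; case: ifP => // _.
      by rewrite rmorphN mulrN.
    rewrite rmatrix_fun_prod.
    rewrite (eq_bigr (fun l => if l.2 then map_mx conjc (skew_circulant n.+1 (y l.1))^T
        else skew_circulant n.+1 (y l.1))); last first.
      move=> [j []] _; last exact: matE.
      exact: (congr1 (fun M : 'M[R[i]]_n.+1 => map_mx conjc M^T) (matE j)).
    rewrite (trace_skew_circulant_word z_inj z_root z_norm); apply: eq_bigr => t _.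
    rewrite (prod_star_word (fun j => skew_eigenvalue z (y j) t)
      (fun j => ((skew_eigenvalue z (y j) t)^*)%C)).
    by apply: eq_bigr => j _; rewrite !eigE.
  rewrite (_ : (fun om => _) = fun om => \sum_(t < n.+1) pw t om); last exact/funext.
  have fpw j t := finite_moments_star_power (input_moments (bnd j))
    (skew_weights n (z t)) (iota 0 n.+1) (K j) (L j).
  rewrite cexpectation_sum => [|t]; last by apply: finite_moments_prod => j.
  apply: eq_bigr => t _; rewrite /pw.
  apply: (decoupled_prod (F := fun j => sigma_of_rmx (random_skew_circulant n.+1 (s j)))).
  - by move=> j E; exact: sigma_of_rmx_measurable.
  - exact: indep_mx.
  - exact: index_enum_uniq.
  - by move=> j; exact: fpw.
  - by move=> j; exact: adapted_star_power.
have -> : ncp_state (rmatrix_ncp P n) (eval_monomial (fun j => inv_sqrt n *: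
    skew_circulant_rmatrix n (bnd j)) (c, w)) =
    c * (n.+1%:R^-1 * \sum_(t < n.+1) \prod_(j < k) x t j) by exact: stateE.
pose e t : R[i] := if z t == -1 then 1 else inv_sqrt n.
have e01 t : 0 <= e t <= 1.
  by rewrite /e; case: ifP => _; rewrite ?ler01 ?lexx// inv_sqrt_ge0 inv_sqrt_le1.
have N0 : (n.+1%:R : R[i]) != 0 by rewrite pnatr_eq0.
have xe t : `|\prod_(j < k) x t j - \prod_(j < k) target j| <= D' * e t.
  by apply: HD' => // j; apply: (HD j).2.
(* at most one root equals [-1] *)
have sume : \sum_(t < n.+1) e t <= n.+1%:R * (inv_sqrt n * 2).
  apply: (@le_trans _ _ (\sum_(t < n.+1) (inv_sqrt n + (z t == -1)%:R))).
    apply: ler_sum => t _; rewrite /e; case: ifP => _; last by rewrite addr0.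
    by rewrite lerDr inv_sqrt_ge0.
  rewrite big_split /= sumr_const card_ord -[inv_sqrt n *+ _]mulr_natl.
  rewrite [inv_sqrt n * 2]mulr_natr mulr2n mulrDr lerD2l.
  apply: (@le_trans _ _ 1).
    rewrite -natr_sum lern1.
    have -> : (\sum_(t < n.+1) (z t == -1)%R)%N = #|[pred t | z t == -1]|.
      by rewrite -sum1_card [RHS]big_mkcond; apply: eq_bigr => t _; rewrite inE; case: (z t == -1).
    apply/card_le1_eqP => t u; rewrite !inE => /eqP zt /eqP zu.
    by apply: z_inj; rewrite zt zu.
  rewrite -[leLHS](inv_sqrt_sqr n) ler_wpM2l// expr2 ler_piMr ?inv_sqrt_ge0//.
  exact: inv_sqrt_le1.
rewrite -mulrBr normrM -mulrA ler_wpM2l//.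
have -> : \prod_(j < k) target j = n.+1%:R^-1 * \sum_(t < n.+1) \prod_(j < k) target j.
  by rewrite sumr_const card_ord -[X in _ * X]mulr_natl mulKf.
rewrite -mulrBr -sumrB normrM ger0_norm ?invr_ge0//.
rewrite mulrC ler_pdivrMr ?ltr0n//.
rewrite (le_trans (ler_norm_sum _ _ _))// (le_trans (ler_sum _ (fun t _ => xe t)))//.
rewrite -mulr_sumr -!mulrA ler_wpM2l// (le_trans sume)//.
by rewrite le_eqVlt; apply/orP; left; apply/eqP; ring.
Qed.
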